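(* Let $f,g$ be regular functions on a symmetric slice domain $\Omega\subseteq\mathbb{H}$. If there exists a 2-sphere (or a singleton) $S=x+y\mathbb{S}\subset\Omega$ (with $x,y\in\mathbb{R}$) such that the zeros of $f-g$ contained in $\Omega\setminus S$ accumulate to a point of $S$, then $f\equiv g$ on the whole $\Omega$.
   Context: $\mathbb{H}$ is the real algebra of quaternions, $\mathbb{S}=\{q\in\mathbb{H}: q^2=-1\}$ is the 2-sphere of imaginary units, and for $I\in\mathbb{S}$, $L_I=\mathbb{R}+I\mathbb{R}\simeq\mathbb{C}$. For $x,y\in\mathbb{R}$, $x+y\mathbb{S}=\{x+yJ: J\in\mathbb{S}\}$ (a 2-sphere if $y\ne 0$, the singleton $\{x\}$ if $y=0$). A domain is a connected open set. For a domain $\Omega\subseteq\mathbb{H}$ put $\Omega_I=\Omega\cap L_I$. A function $f:\Omega\to\mathbb{H}$ on a domain $\Omega\subseteq\mathbb{H}$ is (slice) regular if for every $I\in\mathbb{S}$ the restriction $f_I=f|_{\Omega_I}$ is holomorphic, meaning $f_I\in C^1(\Omega_I)$ and $\frac12\left(\frac{\partial}{\partial x}+I\frac{\partial}{\partial y}\right)f_I(x+Iy)=0$ on $\Omega_I$. A slice domain is a domain $\Omega\subseteq\mathbb{H}$ intersecting the real axis such that $\Omega_I$ is a domain in $L_I$ for all $I\in\mathbb{S}$. A set $C\subseteq\mathbb{H}$ is (axially) symmetric if for all $x+yI\in C$ with $x,y\in\mathbb{R}$, $I\in\mathbb{S}$, the whole set $x+y\mathbb{S}$ is contained in $C$. 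*)

(* Defs.v *)
From HB Require Import structures.
From mathcomp Require Import all_boot all_order all_algebra.
From mathcomp Require Import all_classical all_reals all_analysis.
From mathcomp Require Import ring.

Set Implicit Arguments.
Unset Strict Implicit.
Unset Printing Implicit Defensive.

Import Order.TTheory GRing.Theory Num.Theory.
Import numFieldNormedType.Exports.

Local Open Scope classical_set_scope.
Local Open Scope ring_scope.

(* The quaternion a + b i + c j + d k is the row vector (a, b, c, d); the
   normed-module structure is that of 'rV[R]_4, whose sup norm induces the
   Euclidean topology. *)
Definition quat (R : realType) : Type := 'rV[R]_4.

HB.instance Definition _ (R : realType) := NormedModule.copy (quat R) 'rV[R]_4.
HB.instance Definition _ (R : realType) := Complete.copy (quat R) 'rV[R]_4.

Definition mkquat (R : realType) (a b c d : R) : quat R :=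
  \row_(k < 4) [:: a; b; c; d]`_k.

Definition qcoef (R : realType) (q : quat R) (k : nat) : R := q 0 (inord k).

Definition quat_one (R : realType) : quat R := mkquat 1 0 0 0.

(* Hamilton's product: i^2 = j^2 = k^2 = ijk = -1 *)
Definition quat_mul (R : realType) (p q : quat R) : quat R :=
  let: (a1, b1, c1, d1) := (qcoef p 0, qcoef p 1, qcoef p 2, qcoef p 3) in
  let: (a2, b2, c2, d2) := (qcoef q 0, qcoef q 1, qcoef q 2, qcoef q 3) in
  mkquat (a1 * a2 - b1 * b2 - c1 * c2 - d1 * d2)
         (a1 * b2 + b1 * a2 + c1 * d2 - d1 * c2)
         (a1 * c2 - b1 * d2 + c1 * a2 + d1 * b2)
         (a1 * d2 + b1 * c2 - c1 * b2 + d1 * a2).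

Section QuatAlgebra.
Variable R : realType.
Implicit Types (a b c d s : R) (p q r : quat R).

Lemma qcoef_mkquat a b c d (k : nat) : (k < 4)%N ->
  qcoef (mkquat a b c d) k = [:: a; b; c; d]`_k.
Proof. by move=> k4; rewrite /qcoef mxE inordK. Qed.

Lemma qcoefD p q k : qcoef (p + q) k = qcoef p k + qcoef q k.
Proof. by rewrite /qcoef mxE. Qed.

Lemma qcoefZ s q k : qcoef (s *: q) k = s * qcoef q k.
Proof. by rewrite /qcoef mxE. Qed.

Lemma eq_quat p q : (forall k, (k < 4)%N -> qcoef p k = qcoef q k) -> p = q.
Proof.
by move=> pq; apply/rowP => k; have := pq k (ltn_ord k); rewrite /qcoef inord_val.
Qed.

Let qE := (qcoefD, qcoefZ, qcoef_mkquat).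

Fact quat_mulA : associative (@quat_mul R).
Proof.
move=> p q r; apply: eq_quat => -[|[|[|[|//]]]] _.
all: by rewrite /quat_mul !qE //=; ring.
Qed.

Fact quat_mul1q : left_id (quat_one R) (@quat_mul R).
Proof.
move=> p; apply: eq_quat => -[|[|[|[|//]]]] _.
all: by rewrite /quat_mul /quat_one !qE //=; ring.
Qed.

Fact quat_mulq1 : right_id (quat_one R) (@quat_mul R).
Proof.
move=> p; apply: eq_quat => -[|[|[|[|//]]]] _.
all: by rewrite /quat_mul /quat_one !qE //=; ring.
Qed.

Fact quat_mulDl : left_distributive (@quat_mul R) +%R.
Proof.
move=> p q r; apply: eq_quat => -[|[|[|[|//]]]] _.
all: by rewrite /quat_mul !qE //=; ring.
Qed.

Fact quat_mulDr : right_distributive (@quat_mul R) +%R.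
Proof.
move=> p q r; apply: eq_quat => -[|[|[|[|//]]]] _.
all: by rewrite /quat_mul !qE //=; ring.
Qed.

Fact quat_one_neq0 : quat_one R != 0.
Proof.
apply/eqP => /(congr1 (fun q : quat R => qcoef q 0)) /eqP.
by rewrite qcoef_mkquat //= /qcoef mxE oner_eq0.
Qed.

HB.instance Definition _ := GRing.Zmodule_isNzRing.Build (quat R)
  quat_mulA quat_mul1q quat_mulq1 quat_mulDl quat_mulDr quat_one_neq0.

Fact quat_scaleAl s p q : s *: (p * q) = (s *: p) * q.
Proof.
apply: eq_quat => -[|[|[|[|//]]]] _.
all: by rewrite /GRing.mul/= /quat_mul !qE //=; ring.
Qed.

HB.instance Definition _ := GRing.Lmodule_isLalgebra.Build R (quat R) quat_scaleAl.

Fact quat_scaleAr s p q : s *: (p * q) = p * (s *: q).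
Proof.
apply: eq_quat => -[|[|[|[|//]]]] _.
all: by rewrite /GRing.mul/= /quat_mul !qE //=; ring.
Qed.

HB.instance Definition _ := GRing.Lalgebra_isAlgebra.Build R (quat R) quat_scaleAr.

End QuatAlgebra.

Section SliceRegular.
Variable R : realType.
Local Notation H := (quat R).
Implicit Types (I J : H) (Omega C : set H).

Definition imag_units : set H := [set q | q ^+ 2 = -1].

Definition slice_pt I (z : R * R) : H := z.1%:A + z.2 *: I.

Definition slice_plane I : set H := range (slice_pt I).

Definition sphere (x y : R) : set H :=
  [set slice_pt J (x, y) | J in imag_units].

Definition domain Omega : Prop := open Omega /\ connected Omega.

(* U is a domain of the topological subspace A *)
Definition domain_in (A U : set H) : Prop :=
  [/\ U `<=` A, exists2 V : set H, open V & U = A `&` V & connected U].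

Definition slice_domain Omega : Prop :=
  [/\ domain Omega,
      exists x : R, Omega x%:A &
      forall I, imag_units I ->
        domain_in (slice_plane I) (Omega `&` slice_plane I)].

Definition axially_symmetric C : Prop :=
  forall (x y : R) I, imag_units I -> C (slice_pt I (x, y)) -> sphere x y `<=` C.

Definition C1_on (D : set (R * R)) (F : R * R -> H) : Prop :=
  [/\ forall z, D z -> derivable F z (1, 0),
      forall z, D z -> derivable F z (0, 1),
      {within D, continuous ('D_(1, 0) F)} &
      {within D, continuous ('D_(0, 1) F)}].

(* D, an open subset of R^2, is the domain of F, and F (x, y) = f_I (x + I y) *)
Definition holomorphic_on I (D : set (R * R)) (F : R * R -> H) : Prop :=
  C1_on D F /\
  forall z, D z -> 2^-1 *: ('D_(1, 0) F z + I * 'D_(0, 1) F z) = 0.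

(* The values of f outside the open set Omega are irrelevant. *)
Definition slice_regular Omega (f : H -> H) : Prop :=
  forall I, imag_units I ->
    holomorphic_on I (slice_pt I @^-1` Omega) (f \o slice_pt I).

End SliceRegular.

(* Main.v *)
From HB Require Import structures.
Require Import Defs.
From mathcomp Require Import all_boot all_order all_algebra.
From mathcomp Require Import all_classical all_reals all_analysis.
From mathcomp Require Import ring lra.
Import Order.TTheory GRing.Theory Num.Theory numFieldNormedType.Exports.
Local Open Scope classical_set_scope.
Local Open Scope ring_scope.
Set Implicit Arguments.
Unset Strict Implicit.
Unset Printing Implicit Defensive.

(** Put [h = f - g] and identify every slice of [Omega] with one plane domain
[D], the set of [(x, y)] such that [x + y i] lies in [Omega]; symmetry makes
[D] the same for all imaginary units. The theorem reduces to the identity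
theorem of one complex variable on [D].

The bridge is the representation formula: [h (x + y J) = P (x, y) + J Q (x, y)]
for all imaginary units [J], with [P] and [Q] independent of [J]
([representation_formula]). The pair [(P, Q)] is a stem function: [P + iQ] is
holomorphic with values in the complexification of the quaternions. Hence
[N = sum_k (P_k + i Q_k) ^ 2] is a holomorphic function on [D]; it is the
symmetrization of [h]. If [h (x + y J) = 0] then [P = - J Q], so [P] and [Q]
have the same Euclidean norm and are orthogonal, which means [N (x, y) = 0]
([slice_zero_qdot]). The zeros of [h] lie on different slices, but
[q |-> (Re q, |Im q|)] ([polar]) sends them to zeros of the single function [N],
and because they avoid the sphere [S], their images avoid the image of [S]; so
the zeros of [N] accumulate in [D] and [N = 0]. At a real point [Q = 0], so there
[N = 0] says [|P|^2 = 0]. Thus [P] and [Q] vanish on an interval of the real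
axis, hence on [D], and [h = 0] by the representation formula.

The identity theorem ([identity_theorem]) is proved for C^1 solutions of the
Cauchy-Riemann equations without contour integrals or power series.
Differentiating under the integral sign shows that the mean of such a function
over a circle does not depend on the radius, even if the centre is only a
point of continuity ([circle_mean_value]); this gives a maximum modulus
principle that tolerates isolated exceptional points ([maximum_modulus]). If
the zeros [c_1, c_2, ...] of [F] accumulate at [p], apply it on a square around
[p] to [F ^ 2 / ((z - c_1) ... (z - c_n))]: near [p] each factor [z - c_k] is
less than half as large as on the boundary of the square, so
[|F ^ 2| <= B / 2 ^ n] near [p] for every [n], and [F = 0] there
([accumulating_zeros_bound], [local_identity]). Connectedness does the rest. *)

(** * Gradients of real functions on the plane *)

Section Gradients.
Variable R : realType.
Implicit Types (u v : R * R -> R) (z : R * R).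

Definition has_grad u z (p q : R) := is_diff z u (fun h => p * h.1 + q * h.2).

Lemma is_diff_linear (V W : normedModType R) (f : V -> W) x :
  linear f -> continuous f -> is_diff x f f.
Proof.
move=> lf cf.
pose lM := GRing.isLinear.Build _ _ _ _ _ lf.
pose g : {linear V -> W} := HB.pack f lM.
split; first exact: (linear_differentiable (f := g)).
exact: (@diff_lin _ _ _ g x cf).
Qed.

Lemma is_diff_fst z : is_diff z (@fst R R) (@fst R R).
Proof. by apply: is_diff_linear => // x; exact: cvg_fst. Qed.

Lemma is_diff_snd z : is_diff z (@snd R R) (@snd R R).
Proof. by apply: is_diff_linear => // x; exact: cvg_snd. Qed.

Lemma has_grad_eq u z p q p' q' : p = p' -> q = q' -> has_grad u z p q ->
  has_grad u z p' q'.
Proof. by move=> -> ->. Qed.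

Lemma has_grad_fst z : has_grad fst z 1 0.
Proof.
apply: is_diff_eq (is_diff_fst z) _.
by apply/funext => h; rewrite mul1r mul0r addr0.
Qed.

Lemma has_grad_snd z : has_grad snd z 0 1.
Proof.
apply: is_diff_eq (is_diff_snd z) _.
by apply/funext => h; rewrite mul1r mul0r add0r.
Qed.

Lemma has_grad_cst c z : has_grad (cst c) z 0 0.
Proof.
apply: is_diff_eq (is_diff_cst c z) _.
by apply/funext => h; rewrite !mul0r addr0.
Qed.

Lemma has_gradD u v z p q p' q' : has_grad u z p q -> has_grad v z p' q' ->
  has_grad (fun w => u w + v w) z (p + p') (q + q').
Proof.
move=> gu gv; apply: is_diff_eq (is_diffD gu gv) _.
by apply/funext => h /=; rewrite !fctE /=; ring.
Qed.

Lemma has_gradN u z p q : has_grad u z p q ->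
  has_grad (fun w => - u w) z (- p) (- q).
Proof.
move=> gu; apply: is_diff_eq (is_diffN gu) _.
by apply/funext => h /=; rewrite !fctE /=; ring.
Qed.

Lemma has_gradM u v z p q p' q' : has_grad u z p q -> has_grad v z p' q' ->
  has_grad (fun w => u w * v w) z (u z * p' + v z * p) (u z * q' + v z * q).
Proof.
move=> gu gv; apply: is_diff_eq (is_diffM gu gv) _.
by apply/funext => h /=; rewrite !fctE /GRing.scale /=; ring.
Qed.

Lemma has_gradV u z p q : u z != 0 -> has_grad u z p q ->
  has_grad (fun w => (u w)^-1) z (- p / u z ^+ 2) (- q / u z ^+ 2).
Proof.
move=> u0 gu; have [du eu] := gu; split; first exact: differentiableV.
rewrite diffV//; apply/funext => h /=; rewrite eu.
by rewrite /GRing.scale /=; field.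
Qed.

Lemma has_grad_curve u (f g : R -> R) t p q f' g' :
  has_grad u (f t, g t) p q -> is_derive t 1 f f' -> is_derive t 1 g g' ->
  is_derive t 1 (fun s => u (f s, g s)) (p * f' + q * g').
Proof.
move=> gu [df ef] [dg eg].
have df1 : differentiable f t by exact/derivable1_diffP.
have dg1 : differentiable g t by exact/derivable1_diffP.
have dfg := is_diff_pair (differentiableP df1) (differentiableP dg1).
have := is_diff_comp (f := fun s => (f s, g s)) dfg gu.
move=> [dd dE]; split; first exact: diff_derivable.
rewrite deriveE// dE/= -!deriveE//.
by rewrite ef eg.
Qed.

End Gradients.

(** * Means of holomorphic functions over circles *)

Section CircleMeans.
Variable R : realType.
Notation mu := (@lebesgue_measure R).
Implicit Types (u v a b : R * R -> R) (z : R * R).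

(** Complex functions are handled as pairs of real functions: this says that [u
+ i v] has the complex derivative [a + i b] at [z], with [a] and [b] continuous
there. *)
Definition cdiff u v a b z := [/\ has_grad u z (a z) (- b z),
  has_grad v z (b z) (a z), {for z, continuous a} & {for z, continuous b}].

Lemma has_grad_continuous u z p q : has_grad u z p q -> {for z, continuous u}.
Proof. by move=> [du _]; exact: differentiable_continuous. Qed.

Lemma cvg_pairR (T : Type) (F : set_system T) {FF : Filter F} (f g : T -> R)
  (x y : R) :
  f @ F --> x -> g @ F --> y -> (f t, g t) @[t --> F] --> (x, y).
Proof. by move=> fx gy; exact: (@cvg_pair _ _ _ _ (nbhs x) (nbhs y)). Qed.

Definition circle z (r t : R) : R * R := (z.1 + r * cos t, z.2 + r * sin t).

Lemma continuous_circle z : continuous (fun w : R * R => circle z w.1 w.2).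
Proof.
move=> w; rewrite /circle /continuous_at; apply: cvg_pairR => /=; apply: cvgD;
  (try exact: cvg_cst); apply: cvgM.
- exact: cvg_fst.
- by apply: continuous_cvg; [exact: continuous_cos|exact: cvg_snd].
- exact: cvg_fst.
- by apply: continuous_cvg; [exact: continuous_sin|exact: cvg_snd].
Qed.

Lemma ball_prodP z e w : ball z e w <-> `|z.1 - w.1| < e /\ `|z.2 - w.2| < e.
Proof.
by rewrite ball_prod_normE /ball_/= prod_normE /= gt_max; split =>
  [/andP|[-> ->]].
Qed.

Lemma circle_in z r e t : 0 <= r -> r < e -> ball z e (circle z r t).
Proof.
move=> r0 re; apply/ball_prodP => /=; rewrite !opprD !addrA !subrr !sub0r
  !normrN.
rewrite !normrM ger0_norm//; split; (apply: le_lt_trans re; apply: ler_piMr =>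
  //).
  exact: cos_max.
exact: sin_max.
Qed.

Lemma circle_neq z r t : 0 < r -> circle z r t != z.
Proof.
move=> r0; apply/eqP; case: z => x y [] /eqP + /eqP.
rewrite -subr_eq0 addrAC subrr add0r mulf_eq0 gt_eqF//= => /eqP c0.
rewrite -subr_eq0 addrAC subrr add0r mulf_eq0 gt_eqF//= => /eqP s0.
have := cos2Dsin2 t; rewrite c0 s0 expr0n/= addr0 => /eqP.
by rewrite eq_sym oner_eq0.
Qed.

Lemma circle_integrable (f : R -> R) : continuous f ->
  mu.-integrable `[0, 2 * pi] (EFin \o f).
Proof.
move=> cf; apply: continuous_compact_integrable; first exact: segment_compact.
exact: continuous_subspaceT.
Qed.

(** The radial derivative of [u] at the point of angle [t] is, by the
Cauchy-Riemann equations, the derivative of [t |-> v / r] along the circle; its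
integral over a period vanishes. *)
Lemma circle_mean_derive u v a b z rho :
  (forall w, ball z rho w -> w != z -> cdiff u v a b w) ->
  forall r, 0 < r < rho ->
  is_derive r 1 (fun r => \int[mu]_(t in `[0, 2 * pi]) u (circle z r t)) 0.
Proof.
move=> H r /andP[r0 rrho].
have Hc (s t : R) : 0 < s < rho -> cdiff u v a b (circle z s t).
  by move=> /andP[s0 srho]; apply: H; [apply: circle_in => //;
    exact: ltW|exact: circle_neq].
pose D s t := a (circle z s t) * cos t - b (circle z s t) * sin t.
have dcos (t : R) : is_derive t 1 (@cos R) (- sin t) by exact: is_derive_cos.
have dsin (t : R) : is_derive t 1 (@sin R) (cos t) by exact: is_derive_sin.
have dr (s t : R) : 0 < s < rho -> is_derive s 1 (fun r => u (circle z r t))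
  (D s t).
  move=> sr; have [gu gv ca cb] := Hc s t sr.
  have d1 : is_derive s 1 (fun r => z.1 + r * cos t) (cos t).
    by apply: is_derive_eq; rewrite /GRing.scale /=; ring.
  have d2 : is_derive s 1 (fun r => z.2 + r * sin t) (sin t).
    by apply: is_derive_eq; rewrite /GRing.scale /=; ring.
  by have := has_grad_curve (f := fun s => z.1 + s * cos t)
    (g := fun s => z.2 + s * sin t) (t := s) gu d1 d2; rewrite mulNr.
have dt (s t : R) : 0 < s < rho -> is_derive t 1
  (fun t => v (circle z s t) / s) (D s t).
  move=> sr; have [gu gv ca cb] := Hc s t sr.
  have d1 : is_derive t 1 (fun t => z.1 + s * cos t) (- s * sin t).
    by apply: is_derive_eq; rewrite /GRing.scale /=; ring.
  have d2 : is_derive t 1 (fun t => z.2 + s * sin t) (s * cos t).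
    by apply: is_derive_eq; rewrite /GRing.scale /=; ring.
  have d3 := has_grad_curve (f := fun t => z.1 + s * cos t)
    (g := fun t => z.2 + s * sin t) (t := t) gv d1 d2.
  have s0 : s != 0 by case/andP: sr => /gt_eqF ->.
  apply: is_derive_eq.
  rewrite /GRing.scale /= /D; field.
  exact s0.
have cs (t s : R): 0 < s < rho -> {for (s,t),
  continuous (fun w : R * R => D w.1 w.2)}.
  move=> sr; have [gu gv ca cb] := Hc s t sr.
  have cc := @continuous_circle z (s,t).
  rewrite /D; apply: cvgB; apply: cvgM.
  - exact: (continuous_comp cc).
  - by apply: continuous_cvg; [exact: continuous_cos|exact: cvg_snd].
  - exact: (continuous_comp cc).
  - by apply: continuous_cvg; [exact: continuous_sin|exact: cvg_snd].
have pair_cont (s : R) : continuous (fun t : R => (s, t)).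
  by move=> t; apply: cvg_pairR; [exact: cvg_cst|exact: cvg_id].
have cD (s : R) : 0 < s < rho -> continuous (D s).
  move=> sr t; exact: (continuous_comp (f := fun t : R => (s, t))
    (pair_cont s t) (cs t s sr)).
have cu (s : R) : 0 < s < rho -> continuous (fun t => u (circle z s t)).
  move=> sr t; have [gu gv ca cb] := Hc s t sr.
  apply: (continuous_comp (f := fun t => circle z s t));
    last exact: has_grad_continuous gu.
  exact: (continuous_comp (f := fun t : R => (s, t)) (pair_cont s t)
    (@continuous_circle z (s, t))).
pose K : set (R * R) := `[r / 2, (r + rho) / 2] `*` `[0, 2 * pi].
have cK : compact K by apply: compact_setX; exact: segment_compact.
have Kr w : K w -> 0 < w.1 < rho.
  by move=> [/=]; rewrite !in_itv/= => /andP[h1 h2] _; apply/andP; split; lra.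
have : bounded_set ((fun w => D w.1 w.2) @` K).
  apply: compact_bounded; apply: continuous_compact => //.
  move=> w; apply: continuous_in_subspaceT => {}w /set_mem Kw.
  by case: w Kw => s t Kw; apply: cs; exact: Kr Kw.
move=> /ex_strict_bound_gt0[M M0 HM].
have rI : `]r / 2, (r + rho) / 2[%classic r by rewrite /= in_itv/=; apply/andP;
  split; lra.
have IK s : `]r / 2, (r + rho) / 2[%classic s -> 0 < s < rho.
  by rewrite /= in_itv/= => /andP[h1 h2]; apply/andP; split; lra.
have p1 s t : `]r / 2, (r + rho) / 2[%classic s ->
  partial1of2 (fun s t => u (circle z s t)) s t = D s t.
  by move=> /IK sr; rewrite /partial1of2 derive1E; have [_ ->] := dr s t sr.
have m02 : measurable (`[0, 2 * pi] : set R) by exact: measurable_itv.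
have A1 s : `]r / 2, (r + rho) / 2[%classic s ->
  mu.-integrable `[0, 2 * pi] (EFin \o (fun t => u (circle z s t))).
  by move=> /IK /cu ?; exact: circle_integrable.
have A2 s t : `]r / 2, (r + rho) / 2[%classic s -> `[0, 2 * pi]%classic t ->
  derivable (fun s => u (circle z s t)) s 1.
  by move=> /IK sr _; have [] := dr s t sr.
have A4 : mu.-integrable `[0, 2 * pi] (EFin \o (cst M : R -> R)).
  by apply: circle_integrable; exact: cst_continuous.
have A5 s t : `]r / 2, (r + rho) / 2[%classic s -> `[0, 2 * pi]%classic t ->
    `|partial1of2 (fun s t => u (circle z s t)) s t| <= (cst M : R -> R) t.
  move=> sI tI; rewrite p1//; apply/ltW/HM; exists (s, t) => //; split => //=.
  by move: sI; apply: subset_itv_oo_cc.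
have M0' (t : R) : 0 <= (cst M : R -> R) t by exact: ltW.
have Dab := @derivable_under_integral R _ _ mu (fun s t => u (circle z s t)) _
  m02 _ _ _ rI A1 A2 (cst M) M0' A4 A5.
have Eab := @differentiation_under_integral R _ _ mu
  (fun s t => u (circle z s t)) _ m02 _ _ _ rI A1 A2 (cst M) M0' A4 A5.
split; first exact: Dab.
rewrite -derive1E Eab.
rewrite (@eq_Rintegral _ _ _ mu _ (D r)); last by move=> t _; rewrite p1.
have rr : 0 < r < rho by rewrite r0.
have pi0 : 0 < 2 * pi :> R by rewrite mulr_gt0// pi_gt0.
rewrite /Rintegral (@continuous_FTC2 _ _ (fun t => v (circle z r t) / r))//.
- rewrite /= /circle -[2 * pi]/((1 + 1) * pi) -mulr2n mulr_natl cos2pi sin2pi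
  cos0 sin0.
  by rewrite subrr.
- exact/continuous_subspaceT/cD.
- have cv t : {for t, continuous (fun t => v (circle z r t) / r)}.
    by apply: differentiable_continuous; apply/derivable1_diffP;
      have [] := dt r t rr.
  split => [t _||].
  + by have [] := dt r t rr.
  + exact/cvg_at_right_filter/cv.
  + exact/cvg_at_left_filter/cv.
- by move=> t _; rewrite derive1E; have [_ ->] := dt r t rr.
Qed.

End CircleMeans.

(** * The maximum modulus principle *)

Section MaximumModulus.
Variable R : realType.
Notation mu := (@lebesgue_measure R).
Implicit Types (u v a b : R * R -> R) (z : R * R).

Lemma le_of_le_addM (x y c : R) : 0 < c ->
  (forall e, 0 < e -> x <= y + e * c) -> x <= y.
Proof.
move=> c0 H; apply/ler_addgt0Pl => e e0.
by have := H (e / c) (divr_gt0 e0 c0); rewrite divfK ?gt_eqF// addrC.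
Qed.

Lemma sqr_le_of_norm_le (x y : R) : `|x| <= y -> x ^+ 2 <= y ^+ 2.
Proof.
move=> xy; rewrite -(real_normK (num_real x)) lerXn2r// nnegrE//.
exact: le_trans xy.
Qed.

Lemma continuous_comp_circle u z (r : R) :
  (forall t, {for circle z r t, continuous u}) ->
    continuous (fun t => u (circle z r t)).
Proof.
move=> cu t; apply: (continuous_comp (f := fun t => circle z r t));
  last exact: cu.
apply: (continuous_comp (f := fun t : R => (r, t))
  (g := fun w => circle z w.1 w.2)); last exact: continuous_circle.
by rewrite /prop_for /continuous_at; apply: cvg_pairR;
  [exact: cvg_cst|exact: cvg_id].
Qed.

Lemma pi2_gt0 : 0 < 2 * pi :> R. Proof. by rewrite mulr_gt0// pi_gt0. Qed.

Lemma circle_integral_cst (c : R) : \int[mu]_(t in `[0, 2 * pi]) c = 2 * pi * c.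
Proof.
have E : mu `[0, 2 * pi] = (2 * pi)%:E.
  by rewrite lebesgue_measure_itv/= lte_fin pi2_gt0 -EFinD /= subr0.
have mI : measurable (`[0, 2 * pi] : set R) by exact: measurable_itv.
by rewrite (Rintegral_cst mu mI)/= E mulrC.
Qed.

Lemma dnbhs_ballP z (P : set (R * R)) : (\forall w \near z^', P w) ->
  exists2 e : R, 0 < e & forall w, ball z e w -> w != z -> P w.
Proof.
by move=> /nbhs_ballP[e /= e0 eP]; exists e => // w zw wz; exact: eP.
Qed.

(** The circle integral is constant in the radius, and continuity of [u] at the
centre gives its limit for small radii. Differentiability at the centre itself
would be too strong an assumption for the quotients by linear factors below. *)
Lemma circle_mean_value u v a b z : {for z, continuous u} ->
  (\forall w \near z^', cdiff u v a b w) ->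
  exists2 rho : R, 0 < rho & forall r, 0 < r < rho ->
    continuous (fun t => u (circle z r t)) /\
    \int[mu]_(t in `[0, 2 * pi]) u (circle z r t) = 2 * pi * u z.
Proof.
move=> cu /dnbhs_ballP[rho rho0 H]; exists rho => // r rr.
pose M r := \int[mu]_(t in `[0, 2 * pi]) u (circle z r t).
have cc s : 0 < s < rho -> continuous (fun t => u (circle z s t)).
  move=> /andP[s0 srho]; apply: continuous_comp_circle => t.
  have [gu _ _ _] : cdiff u v a b (circle z s t).
    by apply: H; [apply: circle_in => //; exact: ltW|exact: circle_neq].
  exact: has_grad_continuous gu.
split; first exact: cc.
have dM s : 0 < s < rho -> is_derive s 1 M 0 by move=>
  ?; exact: circle_mean_derive H _ _.
have Mc s : 0 < s -> s < r -> M r = M s.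
  move=> s0 sr; case/andP: rr => r0 rrho.
  have itv x : s <= x <= r -> 0 < x < rho by move=> /andP[]; lra.
  have [||x xsr] := @MVT R M (cst 0) s r sr; rewrite ?mul0r.
  - by move=> x xsr; apply: dM; apply: itv; move: xsr; rewrite in_itv/= =>
    /andP[/ltW -> /ltW ->].
  - apply: derivable_within_continuous => x; rewrite in_itv/= => /itv xx.
    by have [] := dM x xx.
  - by move=> /= /eqP; rewrite subr_eq0 => /eqP.
have small e : 0 < e -> `|M r - 2 * pi * u z| <= 2 * pi * e.
  move=> e0.
  have /nbhs_ballP[d /= d0 dP] : \forall w \near z, `|u z - u w| < e.
    by move/cvgrPdist_lt : cu => /(_ e e0).
  pose s := Num.min (r / 2) (d / 2).
  have s0 : 0 < s by rewrite /s lt_min; apply/andP; split; lra.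
  have sr : s < r by rewrite /s gt_min; apply/orP; left; lra.
  have sd : s < d by rewrite /s gt_min; apply/orP; right; lra.
  have srho : 0 < s < rho by case/andP: rr => *; rewrite s0 (lt_trans sr).
  have mI : measurable (`[0, 2 * pi] : set R) by exact: measurable_itv.
  have iu := circle_integrable (cc s srho).
  have ic (c : R) : mu.-integrable `[0, 2 * pi] (EFin \o (fun _ : R => c)).
    by apply: circle_integrable; exact: cst_continuous.
  rewrite (Mc s)// -circle_integral_cst -RintegralB//.
  have cd : continuous (fun t => u (circle z s t) - u z).
    by move=> t; apply: cvgB; [exact: cc|exact: cvg_cst].
  apply: le_trans (le_normr_Rintegral _ _) _ => //;
    first exact: circle_integrable.
  rewrite -circle_integral_cst; apply: le_Rintegral => //.
    apply: (@circle_integrable _ (fun t => `|u (circle z s t) - u z|)) => t.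
    by apply: cvg_norm; exact: cd.
  move=> t _; rewrite distrC; apply/ltW/dP; apply: circle_in => //; exact: ltW.
apply/eqP; rewrite -subr_eq0 -normr_le0.
by apply: (le_of_le_addM pi2_gt0) => e e0; rewrite add0r [e * _]mulrC;
  exact: small.
Qed.

Lemma le_circle_max u v a b z : {for z, continuous u} ->
  (\forall w \near z^', cdiff u v a b w) ->
  exists2 rho : R, 0 < rho & forall r, 0 < r < rho -> forall c,
    (forall t, u (circle z r t) <= c) -> u z <= c.
Proof.
move=> cu H; have [rho rho0 P] := circle_mean_value cu H; exists rho =>
  // r rr c uc.
have [cc E] := P r rr.
rewrite -(ler_pM2l pi2_gt0) -E -circle_integral_cst.
apply: le_Rintegral => //; first exact: circle_integrable.
by apply: circle_integrable; exact: cst_continuous.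
Qed.

Definition square z (r : R) : set (R * R) :=
  `[z.1 - r, z.1 + r] `*` `[z.2 - r, z.2 + r].

Lemma squareP z r w : square z r w <-> `|w.1 - z.1| <= r /\ `|w.2 - z.2| <= r.
Proof. by rewrite /square /setX /= !in_itv/= !ler_distl. Qed.

(** If [|F|^2 + e |z - p|^2] had its maximum at an interior point, the mean
value property of its linearization there, the real part of a holomorphic
function, would be contradicted by the strictly positive mean of [e |z - w0|^2].
Then let [e] tend to [0]. *)
Lemma maximum_modulus u v a b p (rho M : R) : 0 < rho ->
  (forall w, square p rho w ->
     [/\ {for w, continuous u}, {for w, continuous v} &
     \forall z \near w^', cdiff u v a b z]) ->
  (forall w, square p rho w -> `|w.1 - p.1| = rho \/ `|w.2 - p.2| = rho ->
     u w ^+ 2 + v w ^+ 2 <= M) ->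
  forall w, square p rho w -> u w ^+ 2 + v w ^+ 2 <= M.
Proof.
move=> rho0 H HM w Kw.
have main e : 0 < e -> u w ^+ 2 + v w ^+ 2 <= M + e * (rho ^+ 2 + rho ^+ 2).
  move=> e0.
  pose phi w := u w ^+ 2 + v w ^+ 2 + e * ((w.1 - p.1) ^+ 2 + (w.2 - p.2) ^+ 2).
  have phi_c : {within square p rho, continuous phi}.
    apply: continuous_in_subspaceT => x /set_mem Kx.
    have [cu cv _] := H x Kx.
    rewrite /phi; apply: cvgD; first by apply: cvgD;
      under eq_fun do rewrite expr2; apply: cvgM.
    apply: cvgM; first exact: cvg_cst.
    apply: cvgD; under eq_fun do rewrite expr2; apply: cvgM; apply: cvgB;
      (try exact: cvg_cst); (try exact: cvg_fst); exact: cvg_snd.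
  have cK : compact (square p rho) by apply: compact_setX;
    exact: segment_compact.
  have [|w0 /set_mem Kw0 w0max] := @compact_EVT_max _ R phi (square p rho) _ cK
    phi_c.
    by exists w.
  have [bd|nbd] := pselect (`|w0.1 - p.1| = rho \/ `|w0.2 - p.2| = rho).
    apply: (@le_trans _ _ (phi w)).
      by rewrite /phi lerDl mulr_ge0 ?addr_ge0 ?sqr_ge0// ltW.
    apply: le_trans (w0max w (mem_set Kw)) _; rewrite /phi.
    have [k1 k2] := (squareP _ _ _).1 Kw0.
    by rewrite lerD ?HM// ler_wpM2l ?(ltW e0)// lerD// sqr_le_of_norm_le.
  have [/squareP[k1 k2] [cu cv hol]] := (Kw0, H _ Kw0).
  (* strictly inside the square a circle around w0 fits, and its mean decides *)
  have {}k1 : `|w0.1 - p.1| < rho by rewrite lt_neqAle k1 andbT; apply/eqP =>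
    E; apply: nbd; left.
  have {}k2 : `|w0.2 - p.2| < rho by rewrite lt_neqAle k2 andbT; apply/eqP =>
    E; apply: nbd; right.
  pose A := w0.1 - p.1. pose B := w0.2 - p.2.
  (* U + i V = conj (F w0) * F + e * conj (w0 - p) * id is holomorphic, and
     twice U is the linearization of phi at w0 *)
  pose U w := u w0 * u w + v w0 * v w + e * (A * w.1 + B * w.2).
  pose V w := u w0 * v w - v w0 * u w + e * (A * w.2 - B * w.1).
  pose a' w := u w0 * a w + v w0 * b w + e * A.
  pose b' w := u w0 * b w - v w0 * a w - e * B.
  have cU : {for w0, continuous U}.
    apply: cvgD.
      by apply: cvgD; apply: cvgM; (try exact: cvg_cst).
    by apply: cvgM; [exact: cvg_cst|apply: cvgD; apply: cvgM;
      (try exact: cvg_cst); (try exact: cvg_fst); exact: cvg_snd].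
  have hU : \forall w \near w0^', cdiff U V a' b' w.
    apply: filterS hol => x [gu gv ca cb].
    have gM c f p' q' : has_grad f x p' q' ->
      has_grad (fun w => c * f w) x (c * p') (c * q').
      move=> gf; have := has_gradM (has_grad_cst c x) gf.
      by apply: has_grad_eq; rewrite mulr0 addr0.
    split.
    - have := has_gradD (has_gradD (gM (u w0) _ _ _ gu) (gM (v w0) _ _ _ gv))
         (gM e _ _ _ (has_gradD (gM A _ _ _ (has_grad_fst x))
           (gM B _ _ _ (has_grad_snd x)))).
      by apply: has_grad_eq; rewrite /a' /b'; ring.
    - have := has_gradD (has_gradD (gM (u w0) _ _ _ gv)
      (has_gradN (gM (v w0) _ _ _ gu)))
         (gM e _ _ _ (has_gradD (gM A _ _ _ (has_grad_snd x))
           (has_gradN (gM B _ _ _ (has_grad_fst x))))).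
      by apply: has_grad_eq; rewrite /a' /b'; ring.
    - apply: cvgD; last exact: cvg_cst.
      by apply: cvgD; apply: cvgM => //; exact: cvg_cst.
    - apply: cvgB; last exact: cvg_cst.
      by apply: cvgB; apply: cvgM => //; exact: cvg_cst.
  have [d d0 Pd] := le_circle_max cU hU.
  pose r := Num.min (d / 2) (Num.min (rho - `|A|) (rho - `|B|)).
  have r0 : 0 < r by rewrite /r !lt_min; apply/and3P; split;
    [lra|rewrite subr_gt0..].
  have rd : r < d by rewrite /r gt_min; apply/orP; left; lra.
  have r1 : r <= rho - `|A| by rewrite /r !ge_min lexx !orbT.
  have r2 : r <= rho - `|B| by rewrite /r !ge_min lexx !orbT.
  have : U w0 <= U w0 - e * r ^+ 2 / 2.
    apply: (Pd r) => [|t]; first by rewrite r0.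
    have cost : `|r * cos t| <= r by rewrite normrM (gtr0_norm r0) ler_piMr
      ?cos_max// ltW.
    have sint : `|r * sin t| <= r by rewrite normrM (gtr0_norm r0) ler_piMr
      ?sin_max// ltW.
    have Kc : square p rho (circle w0 r t).
      apply/squareP; split => /=; rewrite addrAC;
        apply: le_trans (ler_normD _ _) _.
        by rewrite -/A; lra.
      by rewrite -/B; lra.
    have := w0max _ (mem_set Kc).
    rewrite /phi /U /circle /= -/(circle w0 r t) -/A -/B.
    have -> : w0.1 + r * cos t - p.1 = A + r * cos t by rewrite /A; ring.
    have -> : w0.2 + r * sin t - p.2 = B + r * sin t by rewrite /B; ring.
    set x := u (circle w0 r t); set y := v (circle w0 r t).
    have cs : (r * cos t) ^+ 2 + (r * sin t) ^+ 2 = r ^+ 2 by rewrite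
      !exprMn -mulrDr cos2Dsin2 mulr1.
    (* |F|^2 = |F0|^2 + 2 <F0, F - F0> + |F - F0|^2 *)
    have := sqr_ge0 (x - u w0); have := sqr_ge0 (y - v w0).
    set C := r * cos t in cs *; set S := r * sin t in cs *.
    have -> : e * r ^+ 2 = e * (C ^+ 2 + S ^+ 2) by rewrite cs.
    nra.
  have : 0 < e * r ^+ 2 by rewrite mulr_gt0// exprn_gt0.
  by lra.
have r20 : 0 < rho ^+ 2 + rho ^+ 2 by rewrite addr_gt0// exprn_gt0.
exact: le_of_le_addM r20 main.
Qed.

End MaximumModulus.

(** * Continuous partial derivatives and quotients by a linear factor *)

Section Holomorphic.
Variable R : realType.
Implicit Types (u v a b : R * R -> R) (z : R * R).

Lemma is_diff_littleo (V W : normedModType R) (f df : V -> W) x :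
  linear df -> continuous df ->
  (forall e : R, 0 < e -> \forall h \near 0,
    `|f (h + x) - (f x + df h)| <= e * `|h|) ->
  is_diff x f df.
Proof.
move=> ldf cdf H.
pose lM := GRing.isLinear.Build _ _ _ _ _ ldf.
pose g : {linear V -> W} := HB.pack df lM.
have E : f \o shift x = cst (f x) + df +o_ 0 id by apply/eqaddoP => e /H.
have dE : 'd f x = df :> (_ -> _) by exact: (@diff_unique _ _ _ f g x cdf).
by split=> //; apply/diff_locallyP; rewrite dE.
Qed.

Lemma has_gradP u z p q : has_grad u z p q <->
  forall e : R, 0 < e -> \forall h \near (0 : R * R),
    `|u (h + z) - (u z + (p * h.1 + q * h.2))| <= e * `|h|.
Proof.
split=> [[du dE]|H].
  move=> e e0.
  by have /eqaddoP/(_ e e0) := diff_locally du; rewrite dE.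
pose df (h : R * R) := p * h.1 + q * h.2.
have ldf : linear df.
  by move=> c h k; rewrite /df /= /GRing.scale/=; ring.
have cdf : continuous df.
  move=> h; apply: cvgD; apply: cvgM; (try exact: cvg_cst);
    (try exact: cvg_fst); exact: cvg_snd.
exact: is_diff_littleo H.
Qed.

Lemma MVT_abs (f df : R -> R) (x h : R) :
  (forall s : R, `|s - x| <= `|h| -> is_derive s 1 f (df s)) ->
  exists2 s, `|s - x| <= `|h| & f (x + h) - f x = df s * h.
Proof.
move=> H; have [h0|h0] := leP 0 h.
  have itv s : x <= s <= x + h -> `|s - x| <= `|h|.
    by move=> /andP[s1 s2]; rewrite !ger0_norm ?subr_ge0//; lra.
  have [|||s sI E] := @MVT_segment R f df x (x + h); first by rewrite lerDl.
  - by move=> s; rewrite in_itv/= => /andP[s1 s2]; apply/H/itv; rewrite !ltW.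
  - apply: derivable_within_continuous => s; rewrite in_itv/= => /itv/H.
    by case.
  - by exists s; [apply: itv; move: sI; rewrite in_itv|rewrite E;
    congr (_ * _); ring].
have itv s : x + h <= s <= x -> `|s - x| <= `|h|.
  by move=> /andP[s1 s2]; rewrite !ler0_norm ?subr_le0//; lra.
have [|||s sI E] := @MVT_segment R f df (x + h) x; first lra.
- by move=> s; rewrite in_itv/= => /andP[s1 s2]; apply/H/itv; rewrite !ltW.
- apply: derivable_within_continuous => s; rewrite in_itv/= => /itv/H.
  by case.
- exists s; [by apply: itv; move: sI; rewrite in_itv|].
  by rewrite -opprB E; ring.
Qed.

Lemma is_derive_partial1 u (x y p : R) :
  is_derive (x, y) ((1, 0) : R * R) u p ->
  is_derive x 1 (fun s => u (s, y)) p.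
Proof.
move=> [du dE].
have E : (fun h : R => h^-1 *: ((u \o shift (x, y)) (h *: (1, 0)) - u (x, y))) =
  (fun h : R => h^-1 *: (((fun s => u (s, y)) \o shift x) (h *: 1) - u (x, y))).
  by apply/funext => h /=; rewrite -[h *: (1, 0) + (x, y)]/(h *: (1 : R) + x,
    h * (0 : R) + y) mulr0 add0r.
by split; [move: du|move: dE]; rewrite /derivable /derive E.
Qed.

Lemma is_derive_partial2 u (x y q : R) :
  is_derive (x, y) ((0, 1) : R * R) u q ->
  is_derive y 1 (fun s => u (x, s)) q.
Proof.
move=> [du dE].
have E : (fun h : R => h^-1 *: ((u \o shift (x, y)) (h *: (0, 1)) - u (x, y))) =
  (fun h : R => h^-1 *: (((fun s => u (x, s)) \o shift y) (h *: 1) - u (x, y))).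
  by apply/funext => h /=; rewrite -[h *: (0, 1) + (x, y)]/(h * (0 : R) + x,
    h *: (1 : R) + y) mulr0 add0r.
by split; [move: du|move: dE]; rewrite /derivable /derive E.
Qed.

(** The mean value theorem along the two sides of a rectangle, and continuity of
the partial derivatives. *)
Lemma C1_has_grad u (p q : R * R -> R) z :
  (\forall w \near z, is_derive w ((1, 0) : R * R) u (p w)) ->
  (\forall w \near z, is_derive w ((0, 1) : R * R) u (q w)) ->
  {for z, continuous p} -> {for z, continuous q} -> has_grad u z (p z) (q z).
Proof.
move=> dp dq cp cq; apply/has_gradP => e e0.
have e2 : 0 < e / 2 by rewrite divr_gt0.
have /nbhs_ballP[d /= d0 dP] : \forall w \near z,
  [/\ is_derive w ((1, 0) : R * R) u (p w),
    is_derive w ((0, 1) : R * R) u (q w),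
      `|p z - p w| < e / 2 & `|q z - q w| < e / 2].
  have c1 : \forall w \near z, `|p z - p w| < e / 2 by move/cvgrPdist_lt : cp;
    apply.
  have c2 : \forall w \near z, `|q z - q w| < e / 2 by move/cvgrPdist_lt : cq;
    apply.
  near=> w; split; near: w => //.
have dP' x y : `|z.1 - x| < d -> `|z.2 - y| < d ->
  [/\ is_derive (x, y) ((1, 0) : R * R) u (p (x, y)),
    is_derive (x, y) ((0, 1) : R * R) u (q (x, y)),
      `|p z - p (x, y)| < e / 2 & `|q z - q (x, y)| < e / 2].
  by move=> h1 h2; apply: dP; apply/ball_prodP.
apply/nbhs_ballP; exists d => //= -[h k] /ball_prodP /= [].
rewrite !sub0r !normrN => hd kd.
case: z dP' {dP dp dq cp cq} => x y /= dP.
have [s sx Es] : exists2 s, `|s - x| <= `|h| & u (x + h, y + k) - u (x, y + k)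
  = p (s, y + k) * h.
  apply: (@MVT_abs (fun s => u (s, y + k)) (fun s => p (s, y + k))) => s sx;
    apply: is_derive_partial1.
  have [] // := dP s (y + k); last by rewrite opprD addNKr normrN.
  by rewrite distrC (le_lt_trans sx).
have [t ty Et] : exists2 t, `|t - y| <= `|k| & u (x, y + k) - u (x, y) = q
  (x, t) * k.
  apply: (@MVT_abs (fun s => u (x, s)) (fun s => q (x, s))) => t ty;
    apply: is_derive_partial2.
  have [] // := dP x t; first by rewrite subrr normr0.
  by rewrite distrC (le_lt_trans ty).
have [_ _ p1 _] : [/\ is_derive (s, y + k) ((1, 0) : R * R) u (p (s, y + k)),
    is_derive (s, y + k) ((0, 1) : R * R) u (q (s, y + k)),
      `|p (x, y) - p (s, y + k)| < e / 2 & `|q (x, y) - q (s, y + k)| < e / 2].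
  apply: dP; last by rewrite opprD addNKr normrN.
  by rewrite distrC (le_lt_trans sx).
have [_ _ _ q1] : [/\ is_derive (x, t) ((1, 0) : R * R) u (p (x, t)),
    is_derive (x, t) ((0, 1) : R * R) u (q (x, t)),
      `|p (x, y) - p (x, t)| < e / 2 & `|q (x, y) - q (x, t)| < e / 2].
  apply: dP; first by rewrite subrr normr0.
  by rewrite distrC (le_lt_trans ty).
have -> : (h, k) + (x, y) = (x + h, y + k) by congr (_, _); rewrite addrC.
have -> : u (x + h, y + k) - (u (x, y) + (p (x, y) * h + q (x, y) * k)) =
  (p (s, y + k) - p (x, y)) * h + (q (x, t) - q (x, y)) * k.
  by rewrite !mulrBl -Es -Et; ring.
have hm : `|h| <= `|(h, k)| by rewrite prod_normE /= le_max lexx.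
have km : `|k| <= `|(h, k)| by rewrite prod_normE /= le_max lexx orbT.
apply: le_trans (ler_normD _ _) _; rewrite !normrM [e]splitr mulrDl.
by apply: lerD; apply: ler_pM => //; rewrite distrC ltW.
Unshelve. all: by end_near. Qed.

Definition sqdist z w := (w.1 - z.1) ^+ 2 + (w.2 - z.2) ^+ 2.

Lemma continuous_sqdist z : continuous (sqdist z).
Proof.
move=> w; apply: cvgD; under eq_fun do rewrite expr2; apply: cvgM; apply: cvgB;
  (try exact: cvg_cst); (try exact: cvg_fst); exact: cvg_snd.
Qed.

Lemma sqdist_gt0 z w : w != z -> 0 < sqdist z w.
Proof.
move=> wz; rewrite lt_neqAle eq_sym addr_ge0 ?sqr_ge0// andbT.
apply: contra wz; rewrite paddr_eq0 ?sqr_ge0// !sqrf_eq0 !subr_eq0.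
by case: z w => ? ? [? ?] /= /andP[/eqP -> /eqP ->].
Qed.

Lemma sqdistxx z : sqdist z z = 0.
Proof. by rewrite /sqdist !subrr expr0n addr0. Qed.

Lemma has_grad_lipschitz u z p q : has_grad u z p q -> u z = 0 ->
  exists2 C : R, 0 <= C & \forall w \near z, u w ^+ 2 <= C * sqdist z w.
Proof.
move=> /has_gradP/(_ 1 ltr01)/nbhs_ballP[d /= d0 dP] uz.
exists ((1 + `|p| + `|q|) ^+ 2); first exact: sqr_ge0.
apply/nbhs_ballP; exists d => //= w /ball_prodP zw.
have := dP (w - z); rewrite subrK uz add0r mul1r => /(_ _).
have wz : ball (0 : R * R) d (w - z).
  by apply/ball_prodP => /=; rewrite !opprB !add0r.
move=> /(_ wz) H.
set h := w - z in H.
have h1 : `|h.1| <= `|h| by rewrite prod_normE /= le_max lexx.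
have h2 : `|h.2| <= `|h| by rewrite prod_normE /= le_max lexx orbT.
have hs : `|h| ^+ 2 <= sqdist z w.
  rewrite /sqdist -[w.1 - z.1]/h.1 -[w.2 - z.2]/h.2 prod_normE.
  rewrite -(real_normK (num_real h.1)) -(real_normK (num_real h.2)).
  by case: (leP `|h.1| `|h.2|) => _; [rewrite lerDr|rewrite lerDl];
    rewrite sqr_ge0.
have : `|u w| <= (1 + `|p| + `|q|) * `|h|.
  rewrite -[u w](subrK (p * h.1 + q * h.2)).
  apply: le_trans (ler_normD _ _) _; rewrite -addrA mulrDl mul1r lerD//.
  apply: le_trans (ler_normD _ _) _; rewrite mulrDl lerD// normrM ler_wpM2l//.
rewrite -(real_normK (num_real (u w))) => uw.
apply: le_trans (ler_wpM2l (sqr_ge0 _) hs).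
rewrite -exprMn lerXn2r// nnegrE// mulr_ge0// !addr_ge0//.
Qed.

(** [quo_re] and [quo_im] are the real and imaginary parts of [(u + i v) / (w -
z)]; since [x / 0 = 0] they take the value [0] at [z]. *)
Definition quo_re u v z w :=
  (u w * (w.1 - z.1) + v w * (w.2 - z.2)) / sqdist z w.
Definition quo_im u v z w :=
  (v w * (w.1 - z.1) - u w * (w.2 - z.2)) / sqdist z w.

Lemma quo_norm u v z w : w != z ->
  quo_re u v z w ^+ 2 + quo_im u v z w ^+ 2 =
    (u w ^+ 2 + v w ^+ 2) / sqdist z w.
Proof.
move=> /sqdist_gt0/lt0r_neq0; rewrite /quo_re /quo_im.
have : sqdist z w = (w.1 - z.1) ^+ 2 + (w.2 - z.2) ^+ 2 by [].
set s := sqdist z w; move: (w.1 - z.1) (w.2 - z.2) => X Y sE s0.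
have -> : (u w ^+ 2 + v w ^+ 2) / s = (u w ^+ 2 + v w ^+ 2) * s / s ^+ 2 by
  field.
by rewrite [in _ * s]sE; field.
Qed.

Lemma quo_normxx u v z : quo_re u v z z ^+ 2 + quo_im u v z z ^+ 2 = 0.
Proof.
by rewrite /quo_re /quo_im !subrr !mulr0 subr0 addr0 mul0r expr0n addr0.
Qed.

Lemma continuous_quo u v z w : w != z -> {for w, continuous u} ->
  {for w, continuous v} ->
  {for w, continuous (quo_re u v z)} /\ {for w, continuous (quo_im u v z)}.
Proof.
move=> wz cu cv.
have c1 : {for w, continuous (fun w : R * R => w.1 - z.1)}.
  by apply: cvgB; [exact: cvg_fst|exact: cvg_cst].
have c2 : {for w, continuous (fun w : R * R => w.2 - z.2)}.
  by apply: cvgB; [exact: cvg_snd|exact: cvg_cst].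
have cV : {for w, continuous (fun w => (sqdist z w)^-1)}.
  apply: cvgV; last exact: continuous_sqdist.
  exact: lt0r_neq0 (sqdist_gt0 wz).
split; apply: cvgM => //.
  by apply: cvgD; exact: cvgM.
by apply: cvgB; exact: cvgM.
Qed.

(** The derivative of [G = F / (w - z)] is [(F' - G) / (w - z)]. *)
Lemma cdiff_quo u v a b z w : w != z -> cdiff u v a b w ->
  cdiff (quo_re u v z) (quo_im u v z)
    (quo_re (fun w => a w - quo_re u v z w) (fun w => b w - quo_im u v z w) z)
    (quo_im (fun w => a w - quo_re u v z w) (fun w => b w - quo_im u v z w) z)
      w.
Proof.
move=> wz [gu gv ca cb].
have s0 := lt0r_neq0 (sqdist_gt0 wz).
have [cq1 cq2] := continuous_quo wz (has_grad_continuous gu)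
  (has_grad_continuous gv).
have g1 : has_grad (fun w => w.1 - z.1) w 1 0.
  by apply: has_grad_eq (has_gradD (has_grad_fst w) (has_grad_cst (- z.1) w));
    rewrite addr0.
have g2 : has_grad (fun w => w.2 - z.2) w 0 1.
  by apply: has_grad_eq (has_gradD (has_grad_snd w) (has_grad_cst (- z.2) w));
    rewrite addr0.
have gs : has_grad (sqdist z) w (2 * (w.1 - z.1)) (2 * (w.2 - z.2)).
  by apply: has_grad_eq (has_gradD (has_gradM g1 g1) (has_gradM g2 g2)); ring.
have gV := has_gradV s0 gs.
have sE : sqdist z w = (w.1 - z.1) ^+ 2 + (w.2 - z.2) ^+ 2 by [].
have [c1 c2] := continuous_quo wz (u := fun w => a w - quo_re u v z w)
  (v := fun w => b w - quo_im u v z w) (cvgB ca cq1) (cvgB cb cq2).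
split => //.
- apply: has_grad_eq (has_gradM (has_gradD (has_gradM gu g1) (has_gradM gv g2))
  gV);
  rewrite /quo_re /quo_im; move: s0; rewrite sE;
    move: (w.1 - z.1) (w.2 - z.2) => X Y s0; field; exact: s0.
- apply: has_grad_eq (has_gradM (has_gradD (has_gradM gv g1)
  (has_gradN (has_gradM gu g2))) gV);
  rewrite /quo_re /quo_im; move: s0; rewrite sE;
    move: (w.1 - z.1) (w.2 - z.2) => X Y s0; field; exact: s0.
Qed.

Lemma cdiffM u v a b u' v' a' b' z : cdiff u v a b z -> cdiff u' v' a' b' z ->
  cdiff (fun w => u w * u' w - v w * v' w) (fun w => u w * v' w + v w * u' w)
    (fun w => (u w * a' w - v w * b' w) + (a w * u' w - b w * v' w))
    (fun w => (u w * b' w + v w * a' w) + (a w * v' w + b w * u' w)) z.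
Proof.
move=> [gu gv ca cb] [gu' gv' ca' cb'].
have cu := has_grad_continuous gu; have cv := has_grad_continuous gv.
have cu' := has_grad_continuous gu'; have cv' := has_grad_continuous gv'.
split.
- by apply: has_grad_eq (has_gradD (has_gradM gu gu')
  (has_gradN (has_gradM gv gv'))); ring.
- by apply: has_grad_eq (has_gradD (has_gradM gu gv') (has_gradM gv gu')); ring.
- by apply: cvgD; apply: cvgB; exact: cvgM.
- by apply: cvgD; apply: cvgD; exact: cvgM.
Qed.

Lemma cdiffD u v a b u' v' a' b' z : cdiff u v a b z -> cdiff u' v' a' b' z ->
  cdiff (fun w => u w + u' w) (fun w => v w + v' w)
    (fun w => a w + a' w) (fun w => b w + b' w) z.
Proof.
move=> [gu gv ca cb] [gu' gv' ca' cb']; split.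
- by apply: has_grad_eq (has_gradD gu gu') => //; ring.
- exact: has_gradD.
- exact: cvgD.
- exact: cvgD.
Qed.

End Holomorphic.

(** * The identity theorem in the plane *)

Section Identity.
Variable R : realType.
Implicit Types (u v a b : R * R -> R) (z : R * R).

Lemma continuous_of_sqr u z (C : R) : u z = 0 ->
  (\forall w \near z, u w ^+ 2 <= C * sqdist z w) -> {for z, continuous u}.
Proof.
move=> uz H; apply/cvgrPdist_lt => e e0; rewrite uz.
have cs : {for z, continuous (fun w => C * sqdist z w)}.
  by apply: cvgM; [exact: cvg_cst|exact: continuous_sqdist].
have e20 : 0 < e ^+ 2 by rewrite exprn_gt0.
have h2 : \forall w \near z, `|C * sqdist z w| < e ^+ 2.
  move/cvgrPdist_lt : cs => /(_ _ e20); rewrite sqdistxx mulr0.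
  by apply: filterS => w; rewrite sub0r normrN.
apply: filterS2 H h2 => w h1 h2; rewrite sub0r normrN.
rewrite -(@ltr_pXn2r _ 2)// ?nnegrE ?ltW// real_normK ?num_real//.
by apply: le_lt_trans h1 (le_lt_trans (ler_norm _) h2).
Qed.

(** Holomorphic up to isolated exceptional points at which continuity persists;
quotients by a linear factor at a double zero stay in this class. *)
Definition punctured_hol u v a b (K : set (R * R)) := forall w, K w ->
  [/\ {for w, continuous u}, {for w, continuous v} & \forall z \near w^',
    cdiff u v a b z].

(** A zero of order at least two, in the form of a bound of the modulus by a
multiple of [|w - z|^2]. *)
Definition double_zero u v z := exists C : R,
  \forall w \near z, u w ^+ 2 + v w ^+ 2 <= C * sqdist z w ^+ 2.

Lemma double_zero0 u v z : double_zero u v z -> u z = 0 /\ v z = 0.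
Proof.
move=> [C /nbhs_singleton]; rewrite sqdistxx expr0n mulr0 => h.
have : u z ^+ 2 + v z ^+ 2 == 0 by rewrite eq_le h addr_ge0 ?sqr_ge0.
by rewrite paddr_eq0 ?sqr_ge0// !sqrf_eq0 => /andP[/eqP -> /eqP ->].
Qed.

Lemma near_neq z w : w != z -> \forall x \near w, x != z.
Proof.
move=> wz.
have h := sqdist_gt0 wz.
have /cvgrPdist_lt/(_ _ h) := @continuous_sqdist _ z w.
apply: filterS => x; apply: contraTneq => ->.
by rewrite sqdistxx subr0 ltr_norml ltxx andbF.
Qed.

(** At [z] the quotient is only known to be continuous: its modulus is [O(|w -
z|)] by the double zero. Elsewhere it is as regular as [u + i v]. *)
Lemma punctured_hol_quo u v a b K z : punctured_hol u v a b K ->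
  double_zero u v z ->
  punctured_hol (quo_re u v z) (quo_im u v z)
    (quo_re (fun w => a w - quo_re u v z w) (fun w => b w - quo_im u v z w) z)
    (quo_im (fun w => a w - quo_re u v z w) (fun w => b w - quo_im u v z w) z)
      K.
Proof.
move=> H [C HC] w Kw; have [cu cv hol] := H w Kw.
have [wz|wz] := eqVneq w z; last first.
  have [c1 c2] := continuous_quo wz cu cv; split=> //.
  have n : \forall x \near w^', x != z by apply: nbhs_dnbhs; exact: near_neq.
  by apply: filterS2 hol n => x hx xz; exact: cdiff_quo.
rewrite wz in hol *.
have nq : \forall x \near z, quo_re u v z x ^+ 2 + quo_im u v z x ^+ 2 <= C *
  sqdist z x.
  apply: filterS HC => x hx; have [->|xz] := eqVneq x z.
    by rewrite quo_normxx sqdistxx mulr0.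
  by rewrite quo_norm// ler_pdivrMr ?sqdist_gt0// -mulrA -expr2.
have := quo_normxx u v z => /eqP; rewrite paddr_eq0 ?sqr_ge0// !sqrf_eq0 =>
  /andP[/eqP q1 /eqP q2].
split.
- apply: (@continuous_of_sqr _ _ C) => //; apply: filterS nq => x;
  apply: le_trans.
  by rewrite lerDl sqr_ge0.
- apply: (@continuous_of_sqr _ _ C) => //; apply: filterS nq => x;
  apply: le_trans.
  by rewrite lerDr sqr_ge0.
- rewrite /dnbhs /prop_near1 /nbhs /=; move: hol;
  apply: filterS2 (withinT _ _) => x /= xz hx.
  exact: cdiff_quo.
Qed.

Lemma double_zero_quo u v z w : w != z -> double_zero u v w ->
  double_zero (quo_re u v z) (quo_im u v z) w.
Proof.
move=> wz [C HC]; have h := sqdist_gt0 wz.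
exists (C / (sqdist z w / 2)).
have h2 : 0 < sqdist z w / 2 by rewrite divr_gt0.
have /cvgrPdist_lt/(_ _ h2) hn := @continuous_sqdist _ z w.
apply: filterS3 HC hn (near_neq wz) => x h1 hx xz.
have {}hx : sqdist z w / 2 < sqdist z x.
  by move: hx; rewrite ltr_norml => /andP[_]; lra.
rewrite quo_norm// mulrAC ler_pdivlMr// mulrAC ler_pdivrMr ?sqdist_gt0//.
have : 0 <= C * sqdist w x ^+ 2 by apply: le_trans h1;
  rewrite addr_ge0 ?sqr_ge0.
move=> C0; apply: ler_pM => //; last exact: ltW.
  by rewrite addr_ge0 ?sqr_ge0.
exact: ltW.
Qed.

(** A Schwarz lemma for infinitely many zeros: dividing by one more [w - c]
divides the boundary bound on [|F|^2] by at least [49/64 rho^2] and costs a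
factor of at most [rho^2 / 8] on the inner square, a gain of more than two. The
remaining zeros still accumulate at [p] because [c] differs from [p]. *)
Lemma accumulating_zeros_bound n : forall u v a b (Z : set (R * R)) p
  (rho B : R), 0 < rho ->
  punctured_hol u v a b (square p rho) ->
  (forall c, Z c -> double_zero u v c) ->
  limit_point Z p ->
  (forall w, square p rho w -> `|w.1 - p.1| = rho \/ `|w.2 - p.2| = rho ->
     u w ^+ 2 + v w ^+ 2 <= B) ->
  forall w, square p (rho / 8) w -> u w ^+ 2 + v w ^+ 2 <= B / 2 ^+ n.
Proof.
elim: n => [|n IH] u v a b Z p rho B rho0 M ZZ lZ HB w Kw.
  rewrite expr0 divr1; apply: (maximum_modulus rho0 M HB).
  by move: Kw => /squareP[k1 k2]; apply/squareP; split; lra.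
have r8 : 0 < rho / 8 by lra.
have [c [cp Zc /ball_prodP[pc1 pc2]]] := lZ _ (nbhsx_ballx p _ r8).
have lZ1 : limit_point (Z `\ c) p.
  move=> U pU.
  have nc : \forall x \near p, x != c by apply: near_neq; rewrite eq_sym.
  have [x [xp Zx [Ux xc]]] := lZ _ (filterI pU nc).
  by exists x; split=> //; split=> //=; exact/eqP.
have B0 : 0 <= B.
  have Kb : square p rho (p.1 + rho, p.2).
    by apply/squareP => /=; rewrite addrAC subrr add0r subrr normr0 gtr0_norm//
      lexx ltW.
  apply: le_trans (HB _ Kb _); first by rewrite addr_ge0 ?sqr_ge0.
  by left; rewrite /= addrAC subrr add0r gtr0_norm.
have [|wc] := eqVneq w c.
  move=> ->; have [-> ->] := double_zero0 (ZZ c Zc).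
  by rewrite expr0n addr0 divr_ge0 ?exprn_ge0.
have := IH _ _ _ _ (Z `\ c) p rho (B / (49 / 64 * rho ^+ 2)) rho0
  (punctured_hol_quo M (ZZ c Zc)) _ lZ1 _ w Kw.
rewrite quo_norm// => main.
have r2 : 0 < rho ^+ 2 by rewrite exprn_gt0.
have sq_lo (x y : R) : 0 <= y -> y <= `|x| -> y ^+ 2 <= x ^+ 2.
  by move=> y0 xy; rewrite -(real_normK (num_real x)) lerXn2r.
have {}main : (u w ^+ 2 + v w ^+ 2) / sqdist c w <= B / (49 / 64 * rho ^+ 2) /
  2 ^+ n.
  apply: main => [d [Zd dc]|x Kx xb]; first by apply: double_zero_quo;
    [exact/eqP|exact: ZZ].
  (* c is within rho / 8 of p, so at least 7 rho / 8 away from the boundary *)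
  have lo : 49 / 64 * rho ^+ 2 <= sqdist c x.
    rewrite /sqdist (_ : 49 / 64 * rho ^+ 2 = (7 / 8 * rho) ^+ 2);
      last by field.
    case: xb => xb.
      apply: (@le_trans _ _ ((x.1 - c.1) ^+ 2)); last by rewrite lerDl sqr_ge0.
      apply: sq_lo; first lra.
      have := ler_normD (x.1 - c.1) (c.1 - p.1);
        rewrite addrA subrK xb (distrC c.1); move: pc1; lra.
    apply: (@le_trans _ _ ((x.2 - c.2) ^+ 2)); last by rewrite lerDr sqr_ge0.
    apply: sq_lo; first lra.
    have := ler_normD (x.2 - c.2) (c.2 - p.2);
      rewrite addrA subrK xb (distrC c.2); move: pc2; lra.
  have s0 : 0 < sqdist c x by apply: lt_le_trans lo; rewrite mulr_gt0.
  have xc : x != c by apply: contraTneq s0 => ->; rewrite sqdistxx ltxx.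
  rewrite quo_norm//; apply: ler_pM; rewrite ?addr_ge0 ?sqr_ge0 ?invr_ge0
    ?(ltW s0)//.
    exact: HB.
  by rewrite lef_pV2// posrE// mulr_gt0.
have s0 := sqdist_gt0 wc.
have hi : sqdist c w <= rho ^+ 2 / 8.
  move: Kw => /squareP[k1 k2].
  have e1 : (w.1 - c.1) ^+ 2 <= (rho / 4) ^+ 2.
    by apply: sqr_le_of_norm_le; have := ler_normD (w.1 - p.1) (p.1 - c.1);
      rewrite addrA subrK; lra.
  have e2 : (w.2 - c.2) ^+ 2 <= (rho / 4) ^+ 2.
    by apply: sqr_le_of_norm_le; have := ler_normD (w.2 - p.2) (p.2 - c.2);
      rewrite addrA subrK; lra.
  rewrite /sqdist; apply: le_trans (lerD e1 e2) _.
  by rewrite le_eqVlt; apply/orP; left; apply/eqP; field.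
rewrite ler_pdivrMr// in main; apply: le_trans main _.
have t0 : 0 < (2 : R) ^+ n by rewrite exprn_gt0.
apply: (@le_trans _ _ (B / (49 / 64 * rho ^+ 2) / 2 ^+ n * (rho ^+ 2 / 8))).
  by apply: ler_wpM2l => //; rewrite !divr_ge0// ?ltW// mulr_gt0.
have -> : B / (49 / 64 * rho ^+ 2) / 2 ^+ n * (rho ^+ 2 / 8) = B / 2 ^+ n *
  (8 / 49).
  by field; rewrite !lt0r_neq0.
have -> : B / 2 ^+ n.+1 = B / 2 ^+ n * (1 / 2) by rewrite exprS; field;
  exact: lt0r_neq0.
by apply: ler_wpM2l; [rewrite divr_ge0// ltW|lra].
Qed.

Lemma le0_of_le_expn (x B : R) : (forall n, x <= B / 2 ^+ n) -> x <= 0.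
Proof.
move=> H.
have : (fun n => B / 2 ^+ n) @ \oo --> B * 0.
  apply: cvgM; first exact: cvg_cst.
  under eq_fun do rewrite -exprVn.
  by apply: cvg_expr; rewrite ger0_norm ?invr_ge0// invf_lt1// ltr1n.
rewrite mulr0 => cB; have cx : cst x @ \oo --> x by exact: cvg_cst.
by apply: (ler_cvg_to cx cB); exact: nearW.
Qed.

(** Squaring makes all zeros double, as the division argument requires. *)
Lemma local_identity u v a b p (Z : set (R * R)) :
  (\forall w \near p, cdiff u v a b w) ->
  (forall z, Z z -> u z = 0 /\ v z = 0) -> limit_point Z p ->
  \forall w \near p, u w = 0 /\ v w = 0.
Proof.
move=> /nbhs_ballP[d /= d0 dP] HZ lZ.
pose rho := d / 2; have rho0 : 0 < rho by rewrite divr_gt0.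
have Kd w : square p rho w -> cdiff u v a b w.
  move=> /squareP[k1 k2]; apply: dP; apply/ball_prodP;
    rewrite !(distrC p.1) !(distrC p.2).
  by rewrite /rho in k1 k2; split; lra.
(* (u + i v) ^ 2, whose zeros are double *)
pose U w := u w * u w - v w * v w; pose V w := u w * v w + v w * u w.
pose A w := (u w * a w - v w * b w) + (a w * u w - b w * v w).
pose B w := (u w * b w + v w * a w) + (a w * v w + b w * u w).
have UV w : U w ^+ 2 + V w ^+ 2 = (u w ^+ 2 + v w ^+ 2) ^+ 2 by rewrite /U /V;
  ring.
have Kc w : ball p d w -> cdiff U V A B w by move=> /dP h; exact: cdiffM.
have M : punctured_hol U V A B (square p rho).
  move=> w Kw.
  have bw : ball p d w.
    move: Kw => /squareP[k1 k2]; apply/ball_prodP;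
      rewrite !(distrC p.1) !(distrC p.2).
    by rewrite /rho in k1 k2; split; lra.
  have [gu gv _ _] := Kc w bw; split.
  - exact: has_grad_continuous gu.
  - exact: has_grad_continuous gv.
  - apply: nbhs_dnbhs.
    have : \forall z \near w, ball p d z by apply: open_nbhs_nbhs; split=> //;
      exact: ball_open.
    exact: filterS.
pose phi w := U w ^+ 2 + V w ^+ 2.
have phi_c : {within square p rho, continuous phi}.
  apply: continuous_in_subspaceT => x /set_mem Kx; have [cu cv _] := M x Kx.
  by apply: cvgD; under eq_fun do rewrite expr2; apply: cvgM.
have cK : compact (square p rho) by apply: compact_setX; exact: segment_compact.
have Kp : square p rho p by apply/squareP; rewrite !subrr normr0 ltW.
have [|w0 _ w0max] := @compact_EVT_max _ R phi (square p rho) _ cK phi_c.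
  by exists p.
have lZ1 : limit_point (Z `&` square p rho) p.
  move=> N pN.
  have := lZ _ (filterI pN (nbhsx_ballx p _ rho0)).
  move=> [x [xp Zx [Nx /ball_prodP[]]]]; rewrite (distrC p.1) (distrC p.2) =>
    bx1 bx2.
  by exists x; split=> //; split=> //; apply/squareP; rewrite !ltW.
have ZZ c : (Z `&` square p rho) c -> double_zero U V c.
  move=> [Zc Kc0]; have [uc vc] := HZ c Zc; have [gu gv _ _] := Kd c Kc0.
  have [C1 C10 H1] := has_grad_lipschitz gu uc;
    have [C2 C20 H2] := has_grad_lipschitz gv vc.
  exists ((C1 + C2) ^+ 2); apply: filterS2 H1 H2 => w h1 h2.
  rewrite UV -exprMn lerXn2r// ?nnegrE ?addr_ge0 ?sqr_ge0//.
    by rewrite mulr_ge0// addr_ge0// sqr_ge0.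
  by rewrite mulrDl lerD.
have r8 : 0 < rho / 8 by rewrite divr_gt0.
apply/nbhs_ballP; exists (rho / 8) => //= w /ball_prodP[b1 b2].
have Kw : square p (rho / 8) w by apply/squareP;
  rewrite (distrC w.1) (distrC w.2) !ltW.
have : U w ^+ 2 + V w ^+ 2 <= 0.
  apply: (@le0_of_le_expn _ (phi w0)) => n.
  apply: (@accumulating_zeros_bound n U V A B _ p rho (phi w0) rho0 M ZZ lZ1 _
    w Kw) => x Kx _.
  exact: (w0max _ (mem_set Kx)).
rewrite UV => h.
have : (u w ^+ 2 + v w ^+ 2) ^+ 2 == 0 by rewrite eq_le h sqr_ge0.
rewrite sqrf_eq0 paddr_eq0 ?sqr_ge0// !sqrf_eq0 => /andP[/eqP -> /eqP ->] //.
Qed.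

(** The points near which [u + i v] vanishes form an open set. It is relatively
closed too: such points accumulate at each boundary point of this set, where the
local statement applies. *)
Lemma identity_theorem u v a b (D : set (R * R)) p (Z : set (R * R)) :
  open D -> connected D -> (forall w, D w -> cdiff u v a b w) ->
  (forall z, Z z -> u z = 0 /\ v z = 0) -> D p -> limit_point Z p ->
  forall w, D w -> u w = 0 /\ v w = 0.
Proof.
move=> oD cD H HZ Dp lZ.
pose O : set (R * R) := [set w : R * R | \forall x \near w, u x = 0 /\ v x = 0].
have Dn w : D w -> \forall x \near w, cdiff u v a b x.
  by move=> Dw; apply: filterS H _; apply: open_nbhs_nbhs.
have oO : open O.
  by rewrite openE => w Ow; apply: nbhs_interior.
have Op : O p by apply: local_identity HZ lZ; exact: Dn.
have E : D `&` O = D.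
  apply: cD.
  - by exists p.
  - by exists O => //; rewrite setIC.
  - exists (closure O); first exact: closed_closure.
    apply/seteqP; split=> x [h1 h2]; split => //; first exact: subset_closure.
    have [//|nO] := pselect (O x).
    apply: (@local_identity u v a b x O); first exact: Dn.
      by move=> z /nbhs_singleton.
    move=> N xN.
    have [y [Oy Ny]] := h2 _ xN.
    by exists y; split=> //; apply/eqP => yx; apply: nO; rewrite -yx.
by move=> w; rewrite -E => -[_ /nbhs_singleton].
Qed.

End Identity.

(** * Stem functions *)

Section Stems.
Variable R : realType.
Local Notation H := (quat R).
Implicit Types (P Q : R * R -> H) (z : R * R).

Lemma linear_quat_continuous (W : normedModType R) (L : H -> W) :
  linear L -> continuous L.
Proof.
move=> lL.
pose lM := GRing.isLinear.Build _ _ _ _ _ lL.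
pose g : {linear H -> W} := HB.pack L lM.
(* a finite sum of coordinates times fixed vectors *)
have -> : L = (fun q : H => \sum_(j < 4) q 0 j *: L (delta_mx 0 j)).
  apply/funext => q; rewrite -[L q]/(g q) [in LHS](row_sum_delta q) linear_sum.
  by apply: eq_bigr => j _; rewrite linearZ.
have c j : continuous (fun q : H => q 0 j *: L (delta_mx 0 j)).
  move=> q; have cj : (fun q : H => q 0 j) @ q -->
    q 0 j by exact: (@coord_continuous R 1 4 0 j q).
  exact: cvgZr_tmp cj.
apply: continuous_big => [|j _]; last exact: c.
exact: add_continuous.
Qed.

(** Difference quotients commute with linear maps. *)
Lemma is_derive_linear (V W : normedModType R) (L : V -> W) (F : R * R -> V)
    z (e : R * R) dF :
  linear L -> continuous L -> is_derive z e F dF ->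
  is_derive z e (L \o F) (L dF).
Proof.
move=> lL cL [dF1 dF2].
pose lM := GRing.isLinear.Build _ _ _ _ _ lL.
pose g : {linear V -> W} := HB.pack L lM.
have E : (fun h : R => h^-1 *: (((L \o F) \o shift z) (h *: e) - (L \o F) z)) =
   L \o (fun h : R => h^-1 *: ((F \o shift z) (h *: e) - F z)).
  apply/funext => h /=; rewrite -![L _]/(g _) -raddfB -linearZ //.
have c : (fun h : R => h^-1 *: (((L \o F) \o shift z) (h *: e) - (L \o F) z)) @
  0^' --> L dF.
  rewrite E; apply: continuous_cvg; first exact: cL.
  by rewrite -dF2; exact: dF1.
by split; [apply/cvg_ex; exists (L dF)|exact/cvg_lim].
Qed.

(** [P + i Q] has the complex derivative [P' + i Q'] in the complexification of
the quaternions, where the new unit [i] commutes with all quaternions. *)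
Definition stem (D : set (R * R)) P Q :=
  exists P' Q' : R * R -> H, forall z, D z ->
  [/\ {for z, continuous P'}, {for z, continuous Q'} &
   [/\ is_derive z ((1, 0) : R * R) P (P' z),
     is_derive z ((0, 1) : R * R) P (- Q' z),
    is_derive z ((1, 0) : R * R) Q (Q' z) & is_derive z ((0, 1) : R * R) Q
      (P' z)]].

Lemma stem_linear D P Q (L : H -> H) : linear L -> stem D P Q ->
  stem D (L \o P) (L \o Q).
Proof.
move=> lL [P' [Q' S]]; exists (L \o P'), (L \o Q') => z /S[cP cQ [d1 d2 d3 d4]].
have cL := linear_quat_continuous lL.
pose lM := GRing.isLinear.Build _ _ _ _ _ lL.
pose g : {linear H -> H} := HB.pack L lM.
split; [exact: (continuous_comp cP (cL _))|exact: (continuous_comp cQ (cL _))|].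
split; try exact: is_derive_linear.
by have := is_derive_linear lL cL d2; rewrite -[L (- _)]/(g _) raddfN.
Qed.

Lemma stemD D P Q P1 Q1 : stem D P Q -> stem D P1 Q1 ->
  stem D (fun z => P z + P1 z) (fun z => Q z + Q1 z).
Proof.
move=> [P' [Q' S]] [P1' [Q1' S1]]; exists (fun z => P' z + P1' z),
  (fun z => Q' z + Q1' z).
move=> z Dz; have [cP cQ [d1 d2 d3 d4]] := S z Dz;
  have [cP1 cQ1 [e1 e2 e3 e4]] := S1 z Dz.
split; [exact: cvgD|exact: cvgD|split].
- exact: is_deriveD.
- by rewrite opprD; exact: is_deriveD.
- exact: is_deriveD.
- exact: is_deriveD.
Qed.

(** Multiplication by [- i]. *)
Lemma stem_rot D P Q : stem D P Q -> stem D Q (fun z => - P z).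
Proof.
move=> [P' [Q' S]]; exists Q', (fun z => - P' z) => z /S[cP cQ [d1 d2 d3 d4]].
split; [exact: cQ|exact: cvgN|split].
- exact: d3.
- by rewrite opprK; exact: d4.
- exact: is_deriveN.
- by have := is_deriveN d2; rewrite opprK.
Qed.

Lemma stem_ext D P Q P1 Q1 : P =1 P1 -> Q =1 Q1 -> stem D P Q -> stem D P1 Q1.
Proof. by move=> /funext -> /funext ->. Qed.

Lemma linear_mull (c : H) : linear (fun q : H => c * q).
Proof. by move=> s p q; rewrite mulrDr scalerAr. Qed.

Lemma linear_qcoef k : linear (fun q : H => qcoef q k).
Proof. by move=> s p q; rewrite qcoefD qcoefZ. Qed.

Lemma stem_mull D P Q c : stem D P Q ->
  stem D (fun z => c * P z) (fun z => c * Q z).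
Proof. exact: stem_linear (linear_mull c). Qed.

Lemma stem_cdiff D P Q : open D -> stem D P Q -> exists P' Q' : R * R -> H,
  forall z, D z -> forall k, cdiff (fun z => qcoef (P z) k)
    (fun z => qcoef (Q z) k)
    (fun z => qcoef (P' z) k) (fun z => qcoef (Q' z) k) z.
Proof.
move=> oD [P' [Q' S]]; exists P', Q' => z Dz k.
have lk := @linear_qcoef k; have ck := linear_quat_continuous lk.
have near_D (G : R * R -> Prop) : (forall w, D w -> G w) ->
  \forall w \near z, G w.
  by move=> DG; apply: filterS DG _; apply: open_nbhs_nbhs.
have [cP cQ _] := S z Dz.
have cP' : {for z, continuous (fun z => qcoef (P' z) k)} by exact:
  (continuous_comp cP (ck _)).
have cQ' : {for z, continuous (fun z => qcoef (Q' z) k)} by exact: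
  (continuous_comp cQ (ck _)).
split => //.
- apply: (@C1_has_grad _ _ (fun z => qcoef (P' z) k)
  (fun z => - qcoef (Q' z) k)) => //.
  + by apply: near_D => w /S[_ _ [d _ _ _]]; exact: (is_derive_linear lk ck d).
  + apply: near_D => w /S[_ _ [_ d _ _]]; have := is_derive_linear lk ck d.
    by rewrite -scaleN1r qcoefZ mulN1r.
  + exact: cvgN.
- apply: (@C1_has_grad _ _ (fun z => qcoef (Q' z) k)
  (fun z => qcoef (P' z) k)) => //.
  + by apply: near_D => w /S[_ _ [_ _ d _]]; exact: (is_derive_linear lk ck d).
  + by apply: near_D => w /S[_ _ [_ _ _ d]]; exact: (is_derive_linear lk ck d).
Qed.

Lemma qcoef0 k : qcoef (0 : H) k = 0. Proof. by rewrite /qcoef mxE. Qed.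

(** Apply the identity theorem to the four complex coordinates. *)
Lemma stem_identity D P Q p (Z : set (R * R)) : open D -> connected D ->
  stem D P Q ->
  (forall z, Z z -> P z = 0 /\ Q z = 0) -> D p -> limit_point Z p ->
  forall z, D z -> P z = 0 /\ Q z = 0.
Proof.
move=> oD cD /(stem_cdiff oD)[P' [Q' S]] HZ Dp lZ z Dz.
have K k : qcoef (P z) k = 0 /\ qcoef (Q z) k = 0.
  apply: (identity_theorem oD cD (fun w Dw => S w Dw k) _ Dp lZ Dz) =>
    w /HZ[-> ->].
  by rewrite qcoef0.
by split; apply: eq_quat => k _; rewrite qcoef0; have [] := K k.
Qed.

(** If [F_x + J F_y = 0], left multiplication by [J] plays the part of [i] on
the values of [F], so that [F - i (J F)] is holomorphic. *)
Lemma holomorphic_stem D J F : open D -> imag_units J -> holomorphic_on J D F ->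
  stem D F (fun z => - (J * F z)).
Proof.
move=> oD; rewrite /imag_units /= expr2 => JJ [[dx dy cx cy] CR].
have lJ := linear_mull J; have cJ := linear_quat_continuous lJ.
pose Fx := 'D_((1, 0) : R * R) F; pose Fy := 'D_((0, 1) : R * R) F.
have FyE z : D z -> Fy z = J * Fx z.
  move=> Dz; have : 2^-1 *: (Fx z + J * Fy z) = 0 by exact: CR.
  move=> /eqP.
  rewrite scaler_eq0 invr_eq0 pnatr_eq0/= addr_eq0 => /eqP ->.
  by rewrite mulrN mulrA JJ mulN1r opprK.
exists Fx, (fun z => - (J * Fx z)) => z Dz.
have cFx : {for z, continuous Fx}.
  move: cx; rewrite continuous_open_subspace// => /(_ z); apply; exact/mem_set.
have d1 : is_derive z ((1, 0) : R * R) F (Fx z) by split; [exact: dx|].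
have d2 : is_derive z ((0, 1) : R * R) F (Fy z) by split; [exact: dy|].
split; [exact: cFx|by apply: cvgN; exact: (continuous_comp cFx (cJ _))|split].
- exact: d1.
- by rewrite opprK -(FyE _ Dz); exact: d2.
- exact: is_deriveN (is_derive_linear lJ cJ d1).
- have -> : Fx z = - (J * Fy z) by rewrite (FyE _ Dz) mulrA JJ mulN1r opprK.
  exact: is_deriveN (is_derive_linear lJ cJ d2).
Qed.

End Stems.

(** * Polar coordinates of quaternions *)

Section Polar.
Variable R : realType.
Local Notation H := (quat R).
Implicit Types (P Q : R * R -> H) (z : R * R) (J q : H).

Lemma qcoef_mul (p q : H) : [/\
  qcoef (p * q) 0 = qcoef p 0 * qcoef q 0 - qcoef p 1 * qcoef q 1
                    - qcoef p 2 * qcoef q 2 - qcoef p 3 * qcoef q 3,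
  qcoef (p * q) 1 = qcoef p 0 * qcoef q 1 + qcoef p 1 * qcoef q 0
                    + qcoef p 2 * qcoef q 3 - qcoef p 3 * qcoef q 2,
  qcoef (p * q) 2 = qcoef p 0 * qcoef q 2 - qcoef p 1 * qcoef q 3
                    + qcoef p 2 * qcoef q 0 + qcoef p 3 * qcoef q 1 &
  qcoef (p * q) 3 = qcoef p 0 * qcoef q 3 + qcoef p 1 * qcoef q 2
                    - qcoef p 2 * qcoef q 1 + qcoef p 3 * qcoef q 0].
Proof. by split; rewrite /GRing.mul/= /quat_mul qcoef_mkquat. Qed.

Lemma qcoefN q k : qcoef (- q) k = - qcoef q k.
Proof. by rewrite /qcoef mxE. Qed.

Lemma qcoef1 : [/\ qcoef (1 : H) 0 = 1, qcoef (1 : H) 1 = 0,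
  qcoef (1 : H) 2 = 0 & qcoef (1 : H) 3 = 0].
Proof. by split; rewrite qcoef_mkquat. Qed.

Lemma imag_unitsP J : imag_units J <->
  qcoef J 0 = 0 /\ qcoef J 1 ^+ 2 + qcoef J 2 ^+ 2 + qcoef J 3 ^+ 2 = 1.
Proof.
have [m0 m1 m2 m3] := qcoef_mul J J; have [w0 w1 w2 w3] := qcoef1.
rewrite /imag_units /= expr2; split=> [JJ|[J0 Jn]].
  rewrite JJ !qcoefN w0 w1 w2 w3 in m0 m1 m2 m3.
  suff J0 : qcoef J 0 = 0 by split=> //; rewrite J0 in m0; nra.
  apply/eqP/negPn/negP => J0.
  have r0 k : 2 * qcoef J 0 * qcoef J k = 0 -> qcoef J k = 0.
    by move/eqP; rewrite !mulf_eq0 pnatr_eq0 (negPf J0) /= => /eqP.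
  have e1 : qcoef J 1 = 0 by apply: r0; nra.
  have e2 : qcoef J 2 = 0 by apply: r0; nra.
  have e3 : qcoef J 3 = 0 by apply: r0; nra.
  rewrite e1 e2 e3 in m0; have := sqr_ge0 (qcoef J 0); nra.
apply: eq_quat => -[|[|[|[|//]]]] _; rewrite qcoefN ?m0 ?m1 ?m2 ?m3 ?w0 ?w1 ?w2
  ?w3 J0; [|ring..].
by rewrite -Jn; ring.
Qed.

Lemma imag_unitsN J : imag_units J -> imag_units (- J).
Proof. by rewrite /imag_units /= sqrrN. Qed.

(** [(Re q, |Im q|)]: its fibres are exactly the spheres [x + y S]. *)
Definition polar q : R * R :=
  (qcoef q 0, Num.sqrt (qcoef q 1 ^+ 2 + qcoef q 2 ^+ 2 + qcoef q 3 ^+ 2)).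

Lemma qcoef_slice_pt J x y : imag_units J ->
  [/\ qcoef (slice_pt J (x, y)) 0 = x,
      qcoef (slice_pt J (x, y)) 1 = y * qcoef J 1,
      qcoef (slice_pt J (x, y)) 2 = y * qcoef J 2 &
      qcoef (slice_pt J (x, y)) 3 = y * qcoef J 3].
Proof.
move=> /imag_unitsP[J0 _]; have [w0 w1 w2 w3] := qcoef1.
by split; rewrite /slice_pt qcoefD !qcoefZ /= ?w0 ?w1 ?w2 ?w3 ?J0 ?mulr1 ?mulr0
  ?addr0 ?add0r.
Qed.

Definition qi : H := mkquat 0 1 0 0.

Lemma imag_units_qi : imag_units qi.
Proof.
by apply/imag_unitsP; rewrite /qi !qcoef_mkquat//= expr1n expr0n !addr0.
Qed.

Lemma polarP q : exists2 J, imag_units J & q = slice_pt J (polar q).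
Proof.
rewrite /polar; set s := _ + _ + qcoef q 3 ^+ 2.
have s0 : 0 <= s by rewrite !addr_ge0 ?sqr_ge0.
have [sE|sN] := eqVneq s 0.
  (* a real quaternion lies on every slice *)
  exists qi; first exact: imag_units_qi.
  have [h0 h1 h2 h3] := qcoef_slice_pt (qcoef q 0) (Num.sqrt s) imag_units_qi.
  have : s == 0 by apply/eqP.
  rewrite /s paddr_eq0 ?addr_ge0 ?sqr_ge0// paddr_eq0 ?sqr_ge0// !sqrf_eq0.
  move=> /andP[/andP[/eqP e1 /eqP e2] /eqP e3].
  apply: eq_quat => -[|[|[|[|//]]]] _;
    rewrite ?h0 ?h1 ?h2 ?h3 ?e1 ?e2 ?e3 ?sE ?sqrtr0 ?mul0r//.
have rs : Num.sqrt s ^+ 2 = s by rewrite sqr_sqrtr.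
have r0 : Num.sqrt s != 0 by rewrite sqrtr_eq0 -ltNge lt_neqAle eq_sym sN.
pose J := mkquat 0 (qcoef q 1 / Num.sqrt s) (qcoef q 2 / Num.sqrt s)
  (qcoef q 3 / Num.sqrt s).
have uJ : imag_units J.
  apply/imag_unitsP; rewrite /J !qcoef_mkquat//=; split=> //.
  by rewrite !exprMn -!mulrDl exprVn rs -/s divff.
exists J => //.
have [h0 h1 h2 h3] := qcoef_slice_pt (qcoef q 0) (Num.sqrt s) uJ.
apply: eq_quat => -[|[|[|[|//]]]] _; rewrite ?h0 ?h1 ?h2 ?h3 ?/J
  ?qcoef_mkquat //=.
all: by rewrite mulrC divfK.
Qed.

Lemma polar_slice_pt J x y : imag_units J ->
  polar (slice_pt J (x, y)) = (x, `|y|).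
Proof.
move=> uJ; have [h0 h1 h2 h3] := qcoef_slice_pt x y uJ;
  have [_ Jn] := (imag_unitsP J).1 uJ.
by rewrite /polar h0 h1 h2 h3 !exprMn -!mulrDr Jn mulr1 sqrtr_sqr.
Qed.

Lemma slice_ptN J x y : slice_pt (- J) (x, y) = slice_pt J (x, - y).
Proof. by rewrite /slice_pt /= scalerN scaleNr. Qed.

Lemma polar_sphere q x y : polar q = (x, `|y|) -> sphere x y q.
Proof.
move=> qE; have [J uJ ->] := polarP q; rewrite qE.
have [y0|y0] := ger0P y; first by exists J.
exists (- J); first exact: imag_unitsN.
by rewrite slice_ptN.
Qed.

Lemma continuous_qcoef k : continuous (fun q : H => qcoef q k).
Proof. by apply: linear_quat_continuous; exact: linear_qcoef. Qed.

Lemma continuous_pairR (T : topologicalType) (f g : T -> R) t :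
  {for t, continuous f} -> {for t, continuous g} ->
    {for t, continuous (fun x => (f x, g x))}.
Proof. by move=> cf cg; rewrite /prop_for /continuous_at; exact: cvg_pairR. Qed.

Lemma continuous_polar : continuous polar.
Proof.
move=> q; have cq k : (fun q : H => qcoef q k) @ q -->
  qcoef q k by exact: continuous_qcoef.
apply: (@continuous_pairR H (fun q => qcoef q 0)
  (fun q => Num.sqrt (qcoef q 1 ^+ 2 + qcoef q 2 ^+ 2 + qcoef q 3 ^+ 2)) q
    (cq 0)).
have c k : (fun q : H => qcoef q k ^+ 2) @ q --> qcoef q k ^+ 2.
  by under eq_fun do rewrite expr2; rewrite expr2; exact: cvgM (cq k) (cq k).
have cs : {for q, continuous (fun q : H =>
  qcoef q 1 ^+ 2 + qcoef q 2 ^+ 2 + qcoef q 3 ^+ 2)}.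
  exact: (cvgD (cvgD (c 1) (c 2)) (c 3)).
exact: (continuous_comp cs (@sqrt_continuous R _)).
Qed.

Lemma continuous_slice_pt J : continuous (slice_pt J).
Proof.
move=> z; rewrite /continuous_at /slice_pt.
have c1 : (fun z : R * R => z.1) @ z --> z.1 by exact: cvg_fst.
have c2 : (fun z : R * R => z.2) @ z --> z.2 by exact: cvg_snd.
exact: cvgD (cvgZr_tmp c1) (cvgZr_tmp c2).
Qed.

Lemma slice_ptK z : (qcoef (slice_pt qi z) 0, qcoef (slice_pt qi z) 1) = z.
Proof.
case: z => x y; have [-> -> _ _] := qcoef_slice_pt x y imag_units_qi.
by rewrite qcoef_mkquat//= mulr1.
Qed.

(** The slice is the image of the plane under an isometric embedding, inverted
by reading off two coordinates. *)
Lemma connected_slice (Omega : set H) :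
  connected (Omega `&` slice_plane qi) -> connected (slice_pt qi @^-1` Omega).
Proof.
move=> cO; pose pr (q : H) := (qcoef q 0, qcoef q 1).
have -> : slice_pt qi @^-1` Omega = pr @` (Omega `&` slice_plane qi).
  apply/seteqP; split=> [z Oz|_ [q [Oq [z _ zq]] <-]].
    by exists (slice_pt qi z); [split=> //; exists z|exact: slice_ptK].
  by rewrite -zq in Oq *; rewrite /preimage /= /pr slice_ptK.
apply: connected_continuous_connected cO _.
apply: continuous_subspaceT => q.
exact: (@continuous_pairR H _ _ q (@continuous_qcoef 0 q)
  (@continuous_qcoef 1 q)).
Qed.

Definition qdot (p q : H) : R :=
  qcoef p 0 * qcoef q 0 + qcoef p 1 * qcoef q 1 +
  qcoef p 2 * qcoef q 2 + qcoef p 3 * qcoef q 3.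

Lemma qdot_eq0 q : qdot q q = 0 -> q = 0.
Proof.
rewrite /qdot -!expr2 => /eqP.
rewrite !paddr_eq0 ?addr_ge0 ?sqr_ge0// !sqrf_eq0.
move=> /andP[/andP[/andP[/eqP e0 /eqP e1] /eqP e2] /eqP e3].
by apply: eq_quat => -[|[|[|[|//]]]] _; rewrite qcoef0.
Qed.

(** [a = - J b], where left multiplication by [J] is an isometry that sends
every vector to an orthogonal one. *)
Lemma slice_zero_qdot J (a b : H) : imag_units J -> a + J * b = 0 ->
  qdot a a = qdot b b /\ qdot a b = 0.
Proof.
move=> /imag_unitsP[J0 Jn] /eqP; rewrite addr_eq0 => /eqP ->.
have [m0 m1 m2 m3] := qcoef_mul J b; rewrite J0 in m0 m1 m2 m3.
rewrite /qdot !qcoefN m0 m1 m2 m3.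
split; last ring.
by set B := RHS; rewrite -[B]mul1r -Jn /B; ring.
Qed.

End Polar.

(** * The representation formula and the symmetrization *)

Section Symmetrization.
Variable R : realType.
Local Notation H := (quat R).
Implicit Types (P Q : R * R -> H) (z : R * R) (J q : H).

Definition plane_domain (Omega : set H) : set (R * R) :=
  slice_pt (qi R) @^-1` Omega.

Lemma axially_symmetric_slice (Omega : set H) J : axially_symmetric Omega ->
  imag_units J ->
  slice_pt J @^-1` Omega = plane_domain Omega.
Proof.
move=> sO uJ; apply/seteqP; split=> -[x y] /= Oz.
  by apply: (sO _ _ _ uJ Oz); exists (qi R) => //; exact: imag_units_qi.
by apply: (sO _ _ _ (imag_units_qi R) Oz); exists J.
Qed.

Lemma slice_regular_stem (Omega : set H) f J : open Omega ->
  axially_symmetric Omega ->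
  slice_regular Omega f -> imag_units J ->
  stem (plane_domain Omega) (f \o slice_pt J)
    (fun z => - (J * (f \o slice_pt J) z)).
Proof.
move=> oO sO rf uJ; rewrite -(axially_symmetric_slice sO uJ).
apply: holomorphic_stem => //; last exact: rf.
by apply: open_comp => // z _; exact: continuous_slice_pt.
Qed.

(** The function is [sum_k (P_k + i Q_k) ^ 2], a sum of squares of holomorphic
functions. *)
Lemma stem_symmetrization D P Q : open D -> stem D P Q ->
  exists a b : R * R -> R, forall z, D z ->
    cdiff (fun z => qdot (P z) (P z) - qdot (Q z) (Q z))
      (fun z => 2 * qdot (P z) (Q z)) a b z.
Proof.
move=> oD /(stem_cdiff oD)[P' [Q' S]]; eexists; eexists => z Dz.
have s k := cdiffM (S z Dz k) (S z Dz k).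
have := cdiffD (cdiffD (s 0) (s 1)) (cdiffD (s 2) (s 3)).
by congr cdiff; apply/funext => w; rewrite /qdot; ring.
Qed.

Lemma real_points_limit (Omega : set H) (x : R) : open Omega -> Omega x%:A ->
  plane_domain Omega (x, 0) /\
  limit_point [set z : R * R | plane_domain Omega z /\ z.2 = 0] (x, 0).
Proof.
move=> oO Ox.
have Dp : plane_domain Omega (x, 0).
  by rewrite /plane_domain /preimage /= /slice_pt /= scale0r addr0.
have oD : open (plane_domain Omega).
  by apply: open_comp => // z _; exact: continuous_slice_pt.
split=> // N pN.
have : nbhs ((x, 0) : R * R) (N `&` plane_domain Omega).
  by apply: filterI => //; apply: open_nbhs_nbhs.
move=> /nbhs_ballP[e /= e0 eP]; exists (x + e / 2, 0).
have [|Ne De] := eP (x + e / 2, 0).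
  apply/ball_prodP; rewrite /= subrr normr0; split=> //.
  by rewrite opprD addNKr normrN gtr0_norm; lra.
by split=> //; apply/eqP => -[]; lra.
Qed.

(** Let [A] and [B] be [h] on the slices of [I] and [- I]. The pair [(P, Q)] is
the mean of the stems [A - i (I A)] and [B + i (I B)]. On the slice of any [J],
both [h] and [P + J Q] are holomorphic for [J], and they agree on the real axis,
where [A = B = h]; the identity theorem makes them equal. *)
Lemma representation_formula (Omega : set H) h : open Omega ->
  connected (plane_domain Omega) ->
  (exists x : R, Omega x%:A) ->
  (forall J, imag_units J -> stem (plane_domain Omega) (h \o slice_pt J)
    (fun z => - (J * (h \o slice_pt J) z))) ->
  exists P Q : R * R -> H, [/\ stem (plane_domain Omega) P Q,
    forall x, Q (x, 0) = 0 &
    forall J z, imag_units J -> plane_domain Omega z ->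
      h (slice_pt J z) = P z + J * Q z].
Proof.
move=> oO cD [x0 Ox0] st; set D := plane_domain Omega in cD st *.
have oD : open D by apply: open_comp => // z _; exact: continuous_slice_pt.
have ui := imag_units_qi R.
have real_pt J x : slice_pt J (x, 0) = x%:A by
  rewrite /slice_pt /= scale0r addr0.
pose P z := 2^-1 *: (h (slice_pt (qi R) z) + h (slice_pt (- qi R) z)).
pose Q z := 2^-1 *: (- (qi R * h (slice_pt (qi R) z)) -
  (- qi R * h (slice_pt (- qi R) z))).
have lZ (c : R) : linear (fun q : H => c *: q).
  by move=> s p q; rewrite scalerDr !scalerA mulrC.
have stPQ : stem D P Q by exact: stem_linear (lZ 2^-1)
  (stemD (st _ ui) (st _ (imag_unitsN ui))).
have P0 x : P (x, 0) = h x%:A.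
  by apply: eq_quat => k _; rewrite /P !real_pt qcoefZ qcoefD; field.
have Q0 x : Q (x, 0) = 0.
  by rewrite /Q !real_pt mulNr subrr scaler0.
exists P, Q; split=> // J z uJ Dz.
have lN : linear (fun q : H => - q) by move=> s p q; rewrite opprD scalerN.
(* the components of h (x + y J) - P - J Q, on the slice of J *)
have sd := stemD (st J uJ) (stemD (stem_linear lN stPQ)
  (stem_mull (- J) (stem_rot stPQ))).
have [Dp lp] := real_points_limit oO Ox0.
have [|+ _] := stem_identity oD cD sd _ Dp lp Dz.
  move=> [x y] [_ /= ->]; rewrite real_pt P0 Q0 oppr0 mulr0 addr0 subrr;
    split => //.
  by rewrite add0r mulrN mulNr opprK addNr.
by rewrite /= mulNr -opprD => /subr0_eq.
Qed.

Lemma polar_mem (Omega : set H) q : axially_symmetric Omega -> Omega q ->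
  plane_domain Omega (polar q).
Proof.
move=> sO; have [J uJ {1}->] := polarP q.
by rewrite -(axially_symmetric_slice sO uJ).
Qed.

End Symmetrization.

Theorem theorem1p13 (R : realType) (Omega : set (quat R)) (f g : quat R -> quat R) :
  slice_domain Omega -> axially_symmetric Omega ->
  slice_regular Omega f -> slice_regular Omega g ->
  (exists x y : R, sphere x y `<=` Omega /\
     exists2 p : quat R, sphere x y p &
       limit_point [set q | (Omega `\` sphere x y) q /\ f q - g q = 0] p) ->
  forall q : quat R, Omega q -> f q = g q.
Proof.
move=> [[oO cO] Oreal Oslice] sO rf rg [x [y [SO [p Sp lp]]]] q Oq.
have ui := imag_units_qi R.
have cD : connected (plane_domain Omega).
  by apply: connected_slice; have [_ _] := Oslice _ ui.
set D := plane_domain Omega in cD *.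
have oD : open D by apply: open_comp => // z _; exact: continuous_slice_pt.
pose h q := f q - g q.
have lN : linear (fun q : quat R => - q) by move=> s ? ?; rewrite opprD scalerN.
have sh J : imag_units J -> stem D (h \o slice_pt J)
  (fun z => - (J * (h \o slice_pt J) z)).
  move=> uJ; have := stemD (slice_regular_stem oO sO rf uJ)
    (stem_linear lN (slice_regular_stem oO sO rg uJ)).
  by apply: stem_ext => z //=; rewrite /h mulrBr opprB opprK addrC.
have [P [Q [stPQ Q0 rep]]] := representation_formula oO cD Oreal sh.
have [a [b holN]] := stem_symmetrization oD stPQ.
have Op : Omega p by exact: SO.
pose Z : set (R * R) := [set z | D z /\ exists2 J,
  imag_units J & h (slice_pt J z) = 0].
have lZ : limit_point Z (polar p).
  move=> N /(continuous_polar (x := p)) pN.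
  have [r [rp [[Or Sr] hr] Nr]] := lp _ pN.
  exists (polar r); split => //.
    apply/eqP => rE; apply: Sr; apply: polar_sphere; rewrite rE.
    by case: Sp => J uJ <-; exact: polar_slice_pt.
  split; first exact: polar_mem.
  by have [J uJ rJ] := polarP r; exists J; rewrite // -rJ.
have N0 z : D z -> qdot (P z) (P z) - qdot (Q z) (Q z) = 0.
  move=> Dz; have [|//] := identity_theorem oD cD holN _ (polar_mem sO Op) lZ
    Dz.
  move=> w [Dw [J uJ]]; rewrite rep// => /(slice_zero_qdot uJ)[-> ->].
  by rewrite subrr mulr0.
pose Z0 : set (R * R) := [set z | D z /\ z.2 = 0].
have PQ0 z : Z0 z -> P z = 0 /\ Q z = 0.
  case: z => s t [Dz /= t0]; rewrite t0 in Dz *; rewrite Q0; split=> //.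
  have := N0 _ Dz; rewrite Q0 [qdot 0 0]/qdot !qcoef0 !mul0r !addr0 subr0.
  exact: qdot_eq0.
have [x0 Ox0] := Oreal.
have [Dp0 lp0] := real_points_limit oO Ox0.
have [Jq uJq qE] := polarP q.
have Dq := polar_mem sO Oq.
have [Pq Qq] := stem_identity oD cD stPQ PQ0 Dp0 lp0 Dq.
by have := rep _ _ uJq Dq; rewrite -qE Pq Qq mulr0 addr0 => /subr0_eq.
Qed.
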